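(* Let $U=(-a,a)$ with $a>0$ and let $H\in C^1(U)$ be even and $\kappa$-semi-convex for some $\kappa>0$. Then the Poincaré constant $\alpha_\beta$ is strictly decreasing in $\beta\geq 0$.
   Context: $H$ is called $\kappa$-semi-convex if $x\mapsto H(x)-\frac{\kappa}{2}|x|^2$ is convex. For $\beta\geq 0$, $\mu_\beta$ is the probability measure on $U$ with Lebesgue density $Z_\beta^{-1}e^{-\beta H(x)}$, where $Z_\beta:=\int_U e^{-\beta H(x)}\,dx<\infty$. $H^1(U,\mu_\beta)$ is the space of weakly differentiable $f:U\to\mathbb{R}$ with $f,f'\in L^2(U,\mu_\beta)$. The Poincaré constant $\alpha_\beta$ is the smallest constant such that $$\int_U f^2\,d\mu_\beta-\Big(\int_U f\,d\mu_\beta\Big)^2\leq\alpha_\beta\int_U|f'|^2\,d\mu_\beta\quad\text{for all }f\in H^1(U,\mu_\beta).$$ *)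

(* Defs.v *)
From HB Require Import structures.
From mathcomp Require Import all_boot all_order all_algebra.
From mathcomp Require Import all_classical all_reals all_analysis.

Set Implicit Arguments.
Unset Strict Implicit.
Unset Printing Implicit Defensive.

Import Order.TTheory GRing.Theory Num.Theory.
Import numFieldNormedType.Exports.

Local Open Scope classical_set_scope.
Local Open Scope ring_scope.

(* Functions on an open set U are represented by total functions R -> R; no
   definition below depends on their values outside U. *)

Section regularity.
Context {R : realType}.
Implicit Types (U : set R) (f g phi H : R -> R).

(* U is meant to be open, so that two-sided derivatives are the right notion. *)
Definition C1_on U H :=
  forall x, U x -> derivable H x 1 /\ {for x, continuous (derive1 H)}.

Definition even_on U H := forall x, U x -> H (- x) = H x.

Definition semi_convex_on U (kappa : R) H :=
  convex_function U (fun x : R => H x - kappa / 2 * `|x| ^+ 2).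

(* C_c^oo(U) *)
Definition test_function U phi :=
  (forall n x, derivable (derive1n n phi) x 1) /\
  exists K : set R,
    [/\ compact K, K `<=` U & forall x, ~ K x -> phi x = 0].

Definition weak_derivative U f g :=
  [/\ locally_integrable U f, locally_integrable U g &
      forall phi, test_function U phi ->
        (\int[lebesgue_measure]_(x in U) (f x * derive1 phi x)%:E =
         - \int[lebesgue_measure]_(x in U) (g x * phi x)%:E)%E].

End regularity.

Section sobolev.
Context {R : realType}.
Variables (mu : set R -> \bar R) (U : set R).
Implicit Types f g : R -> R.

Definition square_integrable f :=
  measurable_fun U f /\ mu.-integrable U (fun x => (f x ^+ 2)%:E).

(* f belongs to H^1(U, mu) and g is (a version of) f' *)
Definition H1_with_derivative f g :=
  [/\ weak_derivative U f g, square_integrable f & square_integrable g].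

(* All the integrals are finite when mu is a probability measure on U. *)
Definition poincare_inequality (c : R) :=
  forall f g, H1_with_derivative f g ->
    (\int[mu]_(x in U) (f x ^+ 2)%:E - (\int[mu]_(x in U) (f x)%:E) ^+ 2
       <= c%:E * \int[mu]_(x in U) (g x ^+ 2)%:E)%E.

Definition is_poincare_constant (c : R) :=
  poincare_inequality c /\ forall c', poincare_inequality c' -> c <= c'.

End sobolev.

Section gibbs.
Context {R : realType}.
Variables (U : set R) (H : R -> R) (beta : R).

Definition gibbs_Z : \bar R :=
  (\int[lebesgue_measure]_(x in U) (expR (- beta * H x))%:E)%E.

Definition gibbs_pdf (x : R) : R := (fine gibbs_Z)^-1 * expR (- beta * H x).

(* A probability measure on U as soon as H is measurable on U and
   0 < gibbs_Z < +oo; both hold for beta >= 0 when U is a bounded interval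
   ]- a, a[ with a > 0 and H is continuous, convex and even on U, since then H
   is bounded below by H 0. *)
Definition gibbs (V : set R) : \bar R :=
  (\int[lebesgue_measure]_(x in V `&` U) (gibbs_pdf x)%:E)%E.

End gibbs.

(* Main.v *)
From HB Require Import structures.
Require Import Defs.
From mathcomp Require Import all_boot all_order all_algebra.
From mathcomp Require Import all_classical all_reals all_analysis.
From mathcomp Require Import measurable_realfun.
From mathcomp Require Import ring lra.

Set Implicit Arguments.
Unset Strict Implicit.
Unset Printing Implicit Defensive.

Import Order.TTheory GRing.Theory Num.Theory.
Import numFieldNormedType.Exports.

Local Open Scope classical_set_scope.
Local Open Scope ring_scope.

(** Write W_b = exp (- b H).  Since W_b is even, the Poincare constant at b is
the best constant c in the Hardy inequality on the half interval

   int_0^a (int_0^x u)^2 W_b(x) dx  <=  c int_0^a u(x)^2 W_b(x) dx.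

Indeed, a function f of H^1 is almost everywhere of the form C + int_0^x f',
so that its variance is at most the integral of (f - C)^2, to which the Hardy
inequality applies on each half of ]-a, a[ ([hardy_poincare]); conversely the
odd primitive of the even extension of u has mean zero, so that its variance
is the integral of its square ([poincare_hardy]).  The version C + int_0^x f'
comes from two facts about weak derivatives: a primitive of a locally
integrable g has weak derivative g ([prim_weak_derivative]), and a function
orthogonal to the derivatives of all test functions is constant almost
everywhere ([du_bois_reymond]).

Substituting u = v / sqrt W_b turns the best constant into the squared norm on
L^2(0, a) of the integral operator with the nonnegative kernel

   K_b(x, y) = exp (- (b / 2) (H x - H y)),   0 < y < x < a,

and what remains are three properties of that norm.  It is positive and
finite ([best_hardy]): H even and convex is nondecreasing on [0, a[, so that
K_b <= 1 for b >= 0.  Its square is convex in b ([hardy_convex]), because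
K_b(x, y) is convex in b and nonnegative.  It tends to 0 as b tends to
infinity ([hardy_of_kernel]): semi-convexity and evenness give
H x - H y >= kappa / 2 (x^2 - y^2) ([even_semi_convex_growth]), so that K_b
concentrates on the diagonal.  A positive convex function that tends to 0 at
infinity is strictly decreasing ([best_hardy_lt]). *)

(** * Integrals of real-valued functions *)

Section real_valued_integrable.
Context d {T : measurableType d} {R : realType} (mu : {measure set T -> \bar R}).
Local Notation "mu .-integrable" := (integrable mu).
Implicit Types (D : set T) (f g h : T -> R).

Lemma integrableZl_EFin D k f : measurable D ->
  mu.-integrable D (EFin \o f) -> mu.-integrable D (fun x => (k * f x)%:E).
Proof. by move=> mD /(integrableZl mD k). Qed.

Lemma integrableD_EFin D f g : measurable D ->
  mu.-integrable D (EFin \o f) -> mu.-integrable D (EFin \o g) ->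
  mu.-integrable D (fun x => (f x + g x)%:E).
Proof. by move=> mD if_ ig; have := integrableD mD if_ ig. Qed.

Lemma integrableB_EFin D f g : measurable D ->
  mu.-integrable D (EFin \o f) -> mu.-integrable D (EFin \o g) ->
  mu.-integrable D (fun x => (f x - g x)%:E).
Proof. by move=> mD if_ ig; have := integrableB mD if_ ig. Qed.

Lemma EFin_Rintegral D f : measurable D -> mu.-integrable D (EFin \o f) ->
  (\int[mu]_(x in D) f x)%:E = (\int[mu]_(x in D) (f x)%:E)%E.
Proof. by move=> mD if_; rewrite /Rintegral fineK//; exact: integrable_fin_num. Qed.

Lemma integrable_mul_bounded D f h (M : R) : measurable D ->
  mu.-integrable D (EFin \o f) -> measurable_fun D h ->
  (forall x, D x -> `|h x| <= M) -> mu.-integrable D (fun x => (f x * h x)%:E).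
Proof.
move=> mD if_ mh hM.
have mf : measurable_fun D f by apply/measurable_EFinP; exact: measurable_int if_.
apply: (le_integrable mD) (integrableZl_EFin M mD (integrable_norm if_)).
  by apply/measurable_EFinP; exact: measurable_funM.
move=> x Dx; rewrite lee_fin/= !normrM normr_id mulrC ler_wpM2r//.
by apply: le_trans (hM _ Dx) (ler_norm _).
Qed.

Lemma patch_support (A B : set T) (F : T -> \bar R) : B `<=` A ->
  (forall x, A x -> ~ B x -> F x = 0%E) -> F \_ A = F \_ B.
Proof.
move=> BA F0; apply/funext => x; rewrite !patchE.
have [xB|xB] := boolP (x \in B).
  by rewrite ifT// inE; apply: BA; rewrite -inE.
by case: ifPn => //; rewrite inE => Ax; apply: F0 => //; move: xB; rewrite notin_setE.
Qed.

Lemma integral_support (A B : set T) (F : T -> \bar R) : B `<=` A ->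
  (forall x, A x -> ~ B x -> F x = 0%E) ->
  (\int[mu]_(x in A) F x = \int[mu]_(x in B) F x)%E.
Proof.
move=> BA F0; by rewrite integral_mkcond [RHS]integral_mkcond (patch_support BA).
Qed.

Lemma integrable_support (A B : set T) (F : T -> \bar R) :
  measurable A -> measurable B -> B `<=` A ->
  (forall x, A x -> ~ B x -> F x = 0%E) ->
  mu.-integrable B F -> mu.-integrable A F.
Proof.
move=> mA mB BA F0; rewrite integrable_mkcond// => iB.
by rewrite integrable_mkcond// (patch_support BA).
Qed.

Lemma integrable_union (A B : set T) (F : T -> \bar R) :
  measurable A -> measurable B ->
  mu.-integrable A F -> mu.-integrable B F -> mu.-integrable (A `|` B) F.
Proof.
move=> mA mB iA iB.
have iBA : mu.-integrable (B `\` A) F.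
  by apply: integrableS iB => //; exact: measurableD.
have mBA : measurable (B `\` A) by exact: measurableD.
have := measurable_int _ iBA; have := measurable_int _ iA => mFA mFB.
have mF : measurable_fun (A `|` B `\` A) F by apply/measurable_funU.
have E : A `|` (B `\` A) = A `|` B by rewrite setUDr setDv setD0.
rewrite -E; apply/integrableP; split=> //.
rewrite ge0_integral_setU//.
- case/integrableP : iA => _ iA; case/integrableP : iBA => _ iBA.
  exact: lte_add_pinfty.
- exact: measurableT_comp.
- by apply/disj_setPS => x [Ax [_]].
Qed.

End real_valued_integrable.

(** * Primitives vanishing at the origin *)

Section primitive.
Context {R : realType}.
Notation mu := (@lebesgue_measure R).
Implicit Types (g : R -> R) (a b x : R).

Lemma lebesgue_itv_lty (b1 b2 : bool) (x y : R) :
  (mu [set` Interval (BSide b1 x) (BSide b2 y)] < +oo)%E.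
Proof. by rewrite lebesgue_measure_itv; case: ifP => _ //=; rewrite -EFinD ltry. Qed.

Lemma lebesgue_itv_fine (b1 b2 : bool) (x y : R) : x <= y ->
  fine (mu [set` Interval (BSide b1 x) (BSide b2 y)]) = y - x.
Proof.
move=> xy; rewrite lebesgue_measure_itv/= lte_fin.
have [//|yx] := ltP x y; have -> : x = y by lra.
by rewrite subrr.
Qed.

Lemma Rintegral_itv_cst (b1 b2 : bool) (x y r : R) : x <= y ->
  \int[mu]_(_ in [set` Interval (BSide b1 x) (BSide b2 y)]) r = r * (y - x).
Proof.
move=> xy; apply: etrans; first exact: Rintegral_cst.
by congr (_ * _); exact: lebesgue_itv_fine.
Qed.

Lemma bounded_itv_integrable (b1 b2 : bool) (x y M : R) (f : R -> R) :
  measurable_fun [set` Interval (BSide b1 x) (BSide b2 y)] f ->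
  (forall z, z \in Interval (BSide b1 x) (BSide b2 y) -> `|f z| <= M) ->
  mu.-integrable [set` Interval (BSide b1 x) (BSide b2 y)] (EFin \o f).
Proof.
move=> mf fM; apply: measurable_bounded_integrable => //.
  exact: lebesgue_itv_lty.
exists M; split => [|z Mz t tI]; first exact: num_real.
by apply: le_trans (ltW Mz); exact: fM.
Qed.

Lemma Rintegral_itv_gt0 (b1 b2 : bool) (x y : R) (f : R -> R) : x < y ->
  mu.-integrable [set` Interval (BSide b1 x) (BSide b2 y)] (EFin \o f) ->
  (forall z, z \in Interval (BSide b1 x) (BSide b2 y) -> 0 < f z) ->
  0 < \int[mu]_(z in [set` Interval (BSide b1 x) (BSide b2 y)]) f z.
Proof.
move=> xy if_ f0; set J := [set` _].
have mJ : measurable J by exact: measurable_itv.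
have f0' z : J z -> 0 <= f z by move=> /f0/ltW.
rewrite lt_neqAle Rintegral_ge0 // andbT eq_sym; apply/negP => /eqP e0.
have mf : measurable_fun J (EFin \o f) by exact: measurable_int if_.
have : (\int[mu]_(z in J) `|(EFin \o f) z| = 0)%E.
  transitivity (\int[mu]_(z in J) (f z)%:E)%E.
    apply: eq_integral => z; rewrite inE => zJ /=.
    by rewrite ger0_norm ?f0'.
  by rewrite -EFin_Rintegral//; exact: (congr1 EFin e0).
move=> /(ae_eq_integral_abs mu mJ mf)[N [mN N0 JN]].
have JN' : J `<=` N.
  move=> z Jz; apply: JN => /= /(_ Jz)/eqP.
  by rewrite eqe gt_eqF//; exact: f0.
have : (mu J <= mu N)%E by apply: le_measure; rewrite ?inE.
rewrite N0 leNgt => /negP; apply.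
rewrite /J lebesgue_measure_itv/= lte_fin xy -EFinB lte_fin; lra.
Qed.

(** The intervals exclude their lower end on both sides of 0, so that the
difference of two values is the integral of g over ]x, y], whatever the
position of 0. *)
Definition prim g x : R :=
  if 0 <= x then \int[mu]_(y in `]0, x]) g y else - \int[mu]_(y in `]x, 0]) g y.

(** Moving the base point to the left of the domain replaces the case
distinction on the sign of x by a single integral with a variable upper end,
the form in which continuity and Fubini apply.  The base point is some -b
inside the domain and not its end point, near which g may fail to be
integrable. *)
Lemma primE g b x : x \in `[- b, b] ->
  mu.-integrable `[- b, b] (EFin \o g) ->
  prim g x = \int[mu]_(y in `[- b, x]) g y - \int[mu]_(y in `[- b, 0]) g y.
Proof.
rewrite in_itv /= => /andP[bx xb] ig.
have b0 : 0 <= b by lra.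
have Nb0 : - b <= 0 by lra.
rewrite /prim; case: ifPn => [x0|]; last rewrite -ltNge => x0.
  rewrite Rintegral_itvB//; apply: integrableS ig => //.
  by apply: subset_itvl; rewrite bnd_simp.
rewrite -opprB Rintegral_itvB// ?bnd_simp//; last exact: ltW.
apply: integrableS ig => //.
by apply: subset_itvl; rewrite bnd_simp.
Qed.

Lemma prim_continuous g b :
  mu.-integrable `[- b, b] (EFin \o g) ->
  {in `]- b, b[, continuous (prim g)}.
Proof.
move=> ig x xb; have xb' := xb.
move: xb'; rewrite in_itv/= => /andP[bx bx'].
have bb : - b < b by lra.
have := parameterized_integral_continuous (ltW bb) ig.
move=> /(continuous_within_itvP _ bb)[c _ _].
have {}c := c x xb.
rewrite /continuous_at.
have -> : prim g x = parameterized_integral mu (- b) x g - \int[mu]_(y in `[- b, 0]) g y.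
  by rewrite (@primE g b)// in_itv/= !ltW.
have c' : (fun z => parameterized_integral mu (- b) z g -
    \int[mu]_(y in `[- b, 0]) g y) @ x -->
    parameterized_integral mu (- b) x g - \int[mu]_(y in `[- b, 0]) g y.
  by apply: (@cvgB _ R^o); [exact: c|exact: cvg_cst].
apply: cvg_trans c'; apply: near_eq_cvg.
near=> z; rewrite /= [RHS](@primE g b)//.
have : z \in `]- b, b[ by near: z; exact: near_in_itvoo.
by rewrite !in_itv/= => /andP[? ?]; rewrite !ltW.
Unshelve. all: by end_near. Qed.

Lemma prim_measurable g a :
  (forall b, b < a -> mu.-integrable `[- b, b] (EFin \o g)) ->
  measurable_fun `]- a, a[ (prim g).
Proof.
move=> ig; apply: open_continuous_measurable_fun; first exact: interval_open.
move=> x; rewrite inE/= in_itv/= => /andP[ax xa].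
(* b is the midpoint between |x| and a. *)
pose b := (Num.max x (- x) + a) / 2.
have xb : - b < x < b.
  by rewrite /b; case: (leP x (- x)) => ?; apply/andP; split; lra.
apply: (@prim_continuous g b); last by rewrite in_itv.
by apply: ig; rewrite /b; case: (leP x (- x)) => ?; lra.
Qed.

End primitive.

(** * The Cauchy-Schwarz inequality *)

Section cauchy_schwarz.
Context d {T : measurableType d} {R : realType} (mu : {measure set T -> \bar R}).
Local Notation "mu .-integrable" := (integrable mu).

(** The minimum over t, at t = - X / P, is (P Q - X^2) / P. *)
Lemma quadratic_discriminant (P X Q : R) :
  (forall t, 0 <= t ^+ 2 * P + 2 * t * X + Q) -> X ^+ 2 <= P * Q.
Proof.
move=> h; have Q0 : 0 <= Q by have := h 0; rewrite expr0n/= !mul0r mulr0 mul0r !add0r.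
have P0 : 0 <= P.
  rewrite leNgt; apply/negP => P0.
  (* For P < 0 the quadratic is negative at this large t. *)
  have := h ((`|X| + Q + 1) / - P * 2 + 1).
  set s := (`|X| + Q + 1) / - P.
  have sP : s * P = - (`|X| + Q + 1).
    by rewrite /s invrN mulrN mulNr divfK// lt_eqF.
  have X0 := normr_ge0 X; have XX := ler_norm X.
  have s0 : 0 <= s by rewrite /s divr_ge0// ?oppr_ge0 ?ltW//; lra.
  move: X0 XX sP s0; move: `|X| => Y Y0 XY sP s0.
  have -> : (s * 2 + 1) ^+ 2 * P + 2 * (s * 2 + 1) * X + Q =
    4 * s * (s * P) + 4 * (s * P) + P + 4 * s * X + 2 * X + Q by ring.
  rewrite sP; nra.
have [P00|Pn0] := eqVneq P 0; last first.
  have Pp : 0 < P by rewrite lt_neqAle eq_sym Pn0.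
  have := h (- X / P).
  have -> : (- X / P) ^+ 2 * P + 2 * (- X / P) * X + Q = (P * Q - X ^+ 2) / P.
    by field.
  by rewrite pmulr_lge0 ?invr_gt0// subr_ge0.
rewrite P00 mul0r; have [->|X0] := eqVneq X 0; first by rewrite expr0n.
(* For P = 0 the affine function of t takes the value -1 here. *)
have := h (- (Q + 1) / (2 * X)).
rewrite P00 mulr0 add0r.
have -> : 2 * (- (Q + 1) / (2 * X)) * X + Q = -1 by field.
by rewrite ler0N1.
Qed.

(** The quadratic in t is the integral of (t f + g)^2; the product f g is
integrable because |f g| <= f^2 + g^2. *)
Lemma cauchy_schwarz (D : set T) (f g : T -> R) : measurable D ->
  measurable_fun D f -> measurable_fun D g ->
  mu.-integrable D (fun x => (f x ^+ 2)%:E) ->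
  mu.-integrable D (fun x => (g x ^+ 2)%:E) ->
  mu.-integrable D (fun x => (f x * g x)%:E) /\
  (\int[mu]_(x in D) (f x * g x)) ^+ 2 <=
  \int[mu]_(x in D) (f x ^+ 2) * \int[mu]_(x in D) (g x ^+ 2).
Proof.
move=> mD mf mg if2 ig2.
have ifg : mu.-integrable D (fun x => (f x * g x)%:E).
  apply: (le_integrable mD) (integrableD mD if2 ig2) => /=.
    exact/measurable_EFinP/measurable_funM.
  move=> x _; rewrite lee_fin [leRHS]ger0_norm ?addr_ge0 ?sqr_ge0//.
  rewrite normrM -(real_normK (num_real (f x))) -(real_normK (num_real (g x))).
  have := normr_ge0 (f x); have := normr_ge0 (g x).
  by move: `|f x| `|g x| => p q; nra.
split=> //; apply: quadratic_discriminant => t.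
have -> : t ^+ 2 * \int[mu]_(x in D) (f x ^+ 2) +
    2 * t * \int[mu]_(x in D) (f x * g x) + \int[mu]_(x in D) (g x ^+ 2) =
    \int[mu]_(x in D) ((t * f x + g x) ^+ 2).
  rewrite -!RintegralZl// -!RintegralD//=.
  - by apply: eq_Rintegral => x _; ring.
  - by apply: integrableD_EFin => //; exact: integrableZl_EFin.
  - exact: integrableZl_EFin.
  - exact: integrableZl_EFin.
by apply: Rintegral_ge0 => x _; exact: sqr_ge0.
Qed.

End cauchy_schwarz.

(** * The Hardy inequality on a half interval *)

Section hardy_definitions.
Context {R : realType}.
Notation mu := (@lebesgue_measure R).
Implicit Types (a : R) (u w H : R -> R) (beta c : R).

(** Restricting the Hardy inequality to nonnegative u does not change its best
constant, because |prim u| <= prim |u|, and lets pointwise inequalities between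
kernels pass to the integrals. *)
Definition admissible a w u := [/\ measurable_fun `]0, a[ u, forall y, 0 <= u y &
  mu.-integrable `]0, a[ (fun y => (u y ^+ 2 * w y)%:E)].

Definition hardy a w c := forall u, admissible a w u ->
  \int[mu]_(x in `]0, a[) (prim u x ^+ 2 * w x)
  <= c * \int[mu]_(x in `]0, a[) (u x ^+ 2 * w x).

Definition gibbs_weight H beta x := expR (- beta * H x).

Lemma gibbs_weight_gt0 H beta x : 0 < gibbs_weight H beta x.
Proof. exact: expR_gt0. Qed.

Lemma gibbs_weight_sqr H beta x :
  gibbs_weight H (beta / 2) x ^+ 2 = gibbs_weight H beta x.
Proof. by rewrite /gibbs_weight -expRM_natl; congr expR; field. Qed.

End hardy_definitions.

Section hardy.
Context {R : realType}.
Notation mu := (@lebesgue_measure R).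
Variables (a : R) (H : R -> R).
Implicit Types (u : R -> R) (beta c : R).
Local Notation I := (`]0, a[%classic : set R).
Local Notation W := (gibbs_weight H).

Hypothesis a0 : 0 < a.
Hypothesis mH : measurable_fun I H.
Hypothesis Hmono : forall x y, 0 <= y -> y <= x -> x < a -> H y <= H x.

Lemma measurable_gibbs_weight beta : measurable_fun I (W beta).
Proof. by apply: measurableT_comp => //; exact: measurable_funM. Qed.

Lemma half_itv_sub x : x \in `]0, a[ -> `]0, x] `<=` I.
Proof.
rewrite in_itv/= => /andP[_ xa]; apply: subset_itvl.
by rewrite bnd_simp.
Qed.

(** With W = W_beta, prim u(x) sqrt W(x) is the integral over ]0, x] of
K(x, y) u(y) sqrt W(y), where K(x, y)^2 = exp (- beta (H x - H y)).
Cauchy-Schwarz bounds its square by the integral of K(x, .)^2 times the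
squared weighted norm of u.  Integrability of u on ]0, x] comes out of the same
computation. *)
Lemma admissible_bound beta u x J : 0 <= beta -> admissible a (W beta) u ->
  x \in `]0, a[ ->
  (\int[mu]_(y in `]0, x]) (expR (- beta * (H x - H y))) <= J)%R ->
  mu.-integrable `]0, x] (EFin \o u) /\
  prim u x ^+ 2 * W beta x <= J * \int[mu]_(y in I) (u y ^+ 2 * W beta y).
Proof.
move=> b0 [mu_ u0 iu] xI kJ.
have sub := half_itv_sub xI.
pose k y := expR (- (beta / 2) * (H x - H y)).
have mk : measurable_fun `]0, x] k.
  apply: measurableT_comp => //; apply: measurable_funM => //.
  by apply: measurable_funB => //; exact: measurable_funS mH.
have k2 y : k y ^+ 2 = expR (- beta * (H x - H y)).
  by rewrite /k -expRM_natl; congr expR; field.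
have ik2 : mu.-integrable `]0, x] (fun y => (k y ^+ 2)%:E).
  apply: (@bounded_itv_integrable _ _ _ _ _ 1).
    exact: measurable_funX.
  move=> y yx; rewrite k2 ger0_norm ?expR_ge0// -[leRHS]expR0 ler_expR.
  rewrite mulNr oppr_le0 mulr_ge0// subr_ge0.
  move: yx xI; rewrite !in_itv/= => /andP[y0 yx] /andP[x0 xa].
  by apply: Hmono => //; exact: ltW.
have muv : measurable_fun `]0, x] (fun y => u y * W (beta / 2) y).
  apply: measurable_funM; first exact: measurable_funS mu_.
  exact: measurable_funS (measurable_gibbs_weight _).
have iuv : mu.-integrable `]0, x] (fun y => ((u y * W (beta / 2) y) ^+ 2)%:E).
  have iu' : mu.-integrable `]0, x] (fun y => (u y ^+ 2 * W beta y)%:E).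
    by apply: integrableS iu.
  by apply: eq_integrable iu' => // y _; rewrite exprMn gibbs_weight_sqr.
have [iuvk cs] := @cauchy_schwarz _ _ _ mu _ _ _ (measurable_itv _) muv mk iuv ik2.
have uvk y : u y * W (beta / 2) y * k y = W (beta / 2) x * u y.
  rewrite -mulrA mulrC; congr (_ * _); rewrite /gibbs_weight /k -expRD.
  by congr expR; ring.
have iu1 : mu.-integrable `]0, x] (EFin \o u).
  have := @integrableZl_EFin _ _ _ mu _ (W (beta / 2) x)^-1 _ (measurable_itv _) iuvk.
  apply: eq_integrable => //= y _; congr EFin.
  by rewrite uvk mulKf// gt_eqF// gibbs_weight_gt0.
split=> //.
have x0 : 0 <= x by move: xI; rewrite in_itv/= => /andP[/ltW].
have -> : prim u x ^+ 2 * W beta x =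
    (\int[mu]_(y in `]0, x]) (u y * W (beta / 2) y * k y)) ^+ 2.
  rewrite /prim x0 -gibbs_weight_sqr -exprMn mulrC -RintegralZl//.
  by congr (_ ^+ 2); apply: eq_Rintegral => y _; rewrite uvk.
apply: (le_trans cs); rewrite mulrC; apply: ler_pM.
- by apply: Rintegral_ge0 => y _; exact: sqr_ge0.
- by apply: Rintegral_ge0 => y _; exact: sqr_ge0.
- by apply: le_trans kJ; under eq_Rintegral do rewrite k2.
- rewrite -lee_fin /Rintegral !fineK; [|exact: integrable_fin_num..].
  under eq_integral do rewrite exprMn gibbs_weight_sqr.
  apply: ge0_subset_integral => //; first exact: measurable_int iu.
  by move=> y _; rewrite lee_fin mulr_ge0 ?sqr_ge0// ltW// gibbs_weight_gt0.
Qed.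

Lemma admissible_integrable beta u x : 0 <= beta -> admissible a (W beta) u ->
  x \in `]0, a[ -> mu.-integrable `]0, x] (EFin \o u).
Proof. by move=> b0 au xI; have [] := admissible_bound b0 au xI (lexx _). Qed.

Lemma admissible_segment_integrable beta u b : 0 <= beta ->
  admissible a (W beta) u -> b < a -> mu.-integrable `[- b, b] (EFin \o (u \_ I)).
Proof.
move=> b0 au ba; rewrite -restrict_EFin; apply/integrable_restrict => //.
have -> : `[- b, b]%classic `&` I = `]0, b]%classic.
  apply/seteqP; split => y /=; rewrite !in_itv/=; first by lra.
  by move=> yb; lra.
have [b0'|b0'] := leP b 0.
  rewrite set_itv_ge ?bnd_simp -?leNgt//; exact: integrable_set0.
by apply: (admissible_integrable b0 au); rewrite in_itv/=; lra.
Qed.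

Lemma admissible_prim_measurable beta u : 0 <= beta ->
  admissible a (W beta) u -> measurable_fun I (prim u).
Proof.
move=> b0 au.
have ii b : b < a -> mu.-integrable `[- b, b] (EFin \o (u \_ I)).
  exact: admissible_segment_integrable au.
have := prim_measurable ii.
move/(measurable_funS (measurable_itv _) (_ : I `<=` `]- a, a[)) => m.
apply: (eq_measurable_fun (prim (u \_ I))); last first.
  apply: m; apply: subset_itvr; rewrite bnd_simp.
  by rewrite oppr_le0 ltW.
move=> x; rewrite inE/= in_itv/= => /andP[x0 xa].
rewrite /prim (ltW x0); apply: eq_Rintegral => y; rewrite inE/= in_itv/= => ?.
by rewrite patchE ifT// inE/= in_itv/=; lra.
Qed.

(** The kernel is at most 1 on the strip x - eta <= y <= x, of length eta, and
at most delta on the rest, of length at most a. *)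
Lemma kernel_integral_le beta x eta delta : 0 <= beta -> 0 <= eta -> 0 <= delta ->
  x \in `]0, a[ ->
  (forall y, 0 < y -> y < x - eta -> expR (- beta * (H x - H y)) <= delta) ->
  \int[mu]_(y in `]0, x]) (expR (- beta * (H x - H y))) <= eta + delta * a.
Proof.
move=> b0 e0 d0 xI kd; have sub := half_itv_sub xI.
move: xI; rewrite in_itv/= => /andP[x0 xa].
have mk : measurable_fun `]0, x] (fun y => expR (- beta * (H x - H y))).
  apply: measurableT_comp => //; apply: measurable_funM => //.
  by apply: measurable_funB => //; exact: measurable_funS mH.
have k1 y : 0 < y <= x -> expR (- beta * (H x - H y)) <= 1.
  move=> /andP[y0 yx]; rewrite -[leRHS]expR0 ler_expR.
  by rewrite mulNr oppr_le0 mulr_ge0// subr_ge0; apply: Hmono => //; exact: ltW.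
have ik : mu.-integrable `]0, x] (fun y => (expR (- beta * (H x - H y)))%:E).
  apply: (@bounded_itv_integrable _ _ _ _ _ 1) => // y; rewrite in_itv/= => yx.
  by rewrite ger0_norm ?expR_ge0// k1.
have i1 : mu.-integrable `]0, x] (fun y => (\1_(`[x - eta, x]) y : R)%:E).
  by apply: (@integrableS _ _ _ _ setT) => //; exact: integrable_indic_itv.
have ic : mu.-integrable `]0, x] (EFin \o cst delta).
  by apply: (@bounded_itv_integrable _ _ _ _ _ `|delta|).
apply: (@le_trans _ _ (\int[mu]_(y in `]0, x]) (\1_(`[x - eta, x]) y + cst delta y))).
  apply: le_Rintegral => //; first exact: integrableD_EFin.
  move=> y; rewrite /= in_itv/= => /andP[y0 yx]; rewrite indicE.
  have [ye|ye] := ltP y (x - eta).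
    by rewrite memNset/= ?add0r ?kd// in_itv/= leNgt ye.
  rewrite mem_set/= ?in_itv/= ?ye//.
  by apply: (le_trans (k1 _ _)); rewrite ?y0// lerDl.
rewrite RintegralD// Rintegral_itv_cst ?(ltW x0)// subr0.
rewrite lerD//; last by rewrite ler_wpM2l// ltW.
apply: (@le_trans _ _ (fine (mu (`[x - eta, x]%classic `&` `]0, x]%classic)))).
  by rewrite /Rintegral integral_indic.
apply: (@le_trans _ _ (fine (mu `[x - eta, x]))).
  have le : (mu (`[(x - eta)%R, x]%classic `&` `]0%R, x]%classic) <= mu `[(x - eta)%R, x])%E.
    by apply: le_measure; rewrite ?inE//; exact: measurableI.
  have fin := lebesgue_itv_lty true false (x - eta) x.
  apply: fine_le => //; rewrite ge0_fin_numE//; exact: le_lt_trans le fin.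
by rewrite lebesgue_itv_fine; lra.
Qed.

(** The function is bounded, by the case eta = a, delta = 0 of the kernel
bound. *)
Lemma admissible_prim_integrable beta u : 0 <= beta ->
  admissible a (W beta) u ->
  mu.-integrable I (fun x => (prim u x ^+ 2 * W beta x)%:E).
Proof.
move=> b0 au.
apply: (@bounded_itv_integrable _ _ _ _ _ (a * \int[mu]_(y in I) (u y ^+ 2 * W beta y))).
  apply: measurable_funM; last exact: measurable_gibbs_weight.
  by apply: measurable_funX; exact: admissible_prim_measurable au.
move=> x xI; rewrite ger0_norm; last by rewrite mulr_ge0 ?sqr_ge0// ltW// gibbs_weight_gt0.
apply: (admissible_bound b0 au xI _).2.
have -> : a = a + 0 * a by ring.
apply: kernel_integral_le => //; first exact: ltW.
move: xI; rewrite in_itv/= => /andP[_ xa] y y0 yx.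
by exfalso; lra.
Qed.

(** Integrating the pointwise bound [admissible_bound] over x contributes the
factor a: this is the Hilbert-Schmidt bound on the norm of the kernel
operator.  It gives a finite constant for every beta >= 0 and small constants
when the kernel concentrates on the diagonal. *)
Lemma hardy_of_kernel beta eta delta : 0 <= beta -> 0 <= eta -> 0 <= delta ->
  (forall x y, 0 < y -> y < x - eta -> x < a -> expR (- beta * (H x - H y)) <= delta) ->
  hardy a (W beta) (a * (eta + delta * a)).
Proof.
move=> b0 e0 d0 kd u au; set N := \int[mu]_(x in I) (u x ^+ 2 * W beta x).
have -> : a * (eta + delta * a) * N = \int[mu]_(x in I) cst ((eta + delta * a) * N) x.
  by rewrite Rintegral_itv_cst ?(ltW a0)//; ring.
apply: le_Rintegral => //.
- exact: admissible_prim_integrable.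
- by apply: (@bounded_itv_integrable _ _ _ _ _ `|(eta + delta * a) * N|).
- move=> x xI; apply: (admissible_bound b0 au xI _).2.
  apply: kernel_integral_le => // y y0 yx; apply: kd => //.
  by move: xI; rewrite /= in_itv/= => /andP[].
Qed.

(** Multiplication by sqrt (W_beta / W_beta'), the isometry from the weighted
L^2 space of beta onto that of beta'.  It lets different inverse temperatures
be compared on one test function. *)
Definition tilt beta beta' u y := u y * expR ((beta' - beta) / 2 * H y).

Lemma tilt_sqr beta beta' u y :
  tilt beta beta' u y ^+ 2 * W beta' y = u y ^+ 2 * W beta y.
Proof.
rewrite /tilt /gibbs_weight exprMn -[LHS]mulrA -expRM_natl -expRD; congr (_ * expR _).
by field.
Qed.

Lemma admissible_tilt beta beta' u : admissible a (W beta) u ->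
  admissible a (W beta') (tilt beta beta' u).
Proof.
move=> [mu_ u0 iu]; split.
- apply: measurable_funM => //; apply: measurableT_comp => //.
  exact: measurable_funM.
- by move=> y; rewrite mulr_ge0 ?expR_ge0.
- by apply: eq_integrable iu => // y _; rewrite tilt_sqr.
Qed.

(** After cancellation of a common positive factor the claim on the kernels is
1 <= t1 exp ((beta1 - beta) z) + t2 exp ((beta2 - beta) z) with
z = (H y - H x) / 2, which follows from exp r >= 1 + r, as the linear terms
cancel. *)
Lemma prim_tilt_convex beta beta1 beta2 t1 t2 u x :
  0 <= t1 -> 0 <= t2 -> t1 + t2 = 1 -> beta = t1 * beta1 + t2 * beta2 ->
  0 <= beta -> 0 <= beta1 -> 0 <= beta2 ->
  admissible a (W beta) u -> x \in `]0, a[ ->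
  prim u x * W (beta / 2) x <=
    t1 * (prim (tilt beta beta1 u) x * W (beta1 / 2) x) +
    t2 * (prim (tilt beta beta2 u) x * W (beta2 / 2) x).
Proof.
move=> t10 t20 t12 bE b0 b10 b20 au xI.
have x0 : 0 <= x by move: xI; rewrite in_itv/= => /andP[/ltW].
have iu := admissible_integrable b0 au xI.
have iu1 := admissible_integrable b10 (admissible_tilt beta1 au) xI.
have iu2 := admissible_integrable b20 (admissible_tilt beta2 au) xI.
rewrite /prim x0 mulrC (mulrC (Rintegral _ _ _)) (mulrC (Rintegral _ _ _) (W (beta2 / 2) x)).
rewrite !mulrA -!RintegralZl// -RintegralD//=; [|exact: integrableZl_EFin..].
apply: le_Rintegral => //.
- exact: integrableZl_EFin.
- by apply: integrableD_EFin => //; exact: integrableZl_EFin.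
move=> y yx; case: au => _ u0 _.
pose z := (H y - H x) / 2.
have e1 b : W (b / 2) x * tilt beta b u y =
    W (beta / 2) x * u y * expR ((b - beta) * z).
  rewrite /gibbs_weight /tilt mulrCA -expRD [RHS]mulrAC -expRD mulrC.
  by congr (expR _ * _); rewrite /z; field.
rewrite -!mulrA !e1 mulrCA (mulrCA t2) -mulrDr ler_peMr ?mulr_ge0 ?expR_ge0//.
have h1 := expR_ge1Dx ((beta1 - beta) * z).
have h2 := expR_ge1Dx ((beta2 - beta) * z).
apply: le_trans (lerD (ler_wpM2l t10 h1) (ler_wpM2l t20 h2)).
have -> : t1 * (1 + (beta1 - beta) * z) + t2 * (1 + (beta2 - beta) * z) =
  (t1 + t2) + (t1 * beta1 + t2 * beta2) * z - (t1 + t2) * beta * z by ring.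
by rewrite t12 -bE; lra.
Qed.

Lemma sqr_le_convex (t1 t2 x y z : R) : 0 <= t1 -> 0 <= t2 -> t1 + t2 = 1 ->
  0 <= z -> z <= t1 * x + t2 * y -> z ^+ 2 <= t1 * x ^+ 2 + t2 * y ^+ 2.
Proof.
move=> t10 t20 t12 z0 zxy; apply: (@le_trans _ _ ((t1 * x + t2 * y) ^+ 2)).
  by rewrite ler_pXn2r// nnegrE (le_trans z0).
rewrite -subr_ge0.
have -> : t1 * x ^+ 2 + t2 * y ^+ 2 - (t1 * x + t2 * y) ^+ 2 =
  t1 * t2 * (x - y) ^+ 2 + (1 - (t1 + t2)) * (t1 * x ^+ 2 + t2 * y ^+ 2) by ring.
by rewrite t12 subrr mul0r addr0 mulr_ge0 ?sqr_ge0// mulr_ge0.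
Qed.

(** In the variable u sqrt W, the two sides of the Hardy inequality are the
squared norm of K_beta v and c times that of v.  The first is convex in beta,
since K_beta v is so pointwise and nonnegative, and the second is independent
of beta: averaging the inequalities at beta1 and beta2 gives the one at
beta. *)
Lemma hardy_convex beta beta1 beta2 t1 t2 c1 c2 :
  0 <= t1 -> 0 <= t2 -> t1 + t2 = 1 -> beta = t1 * beta1 + t2 * beta2 ->
  0 <= beta -> 0 <= beta1 -> 0 <= beta2 ->
  hardy a (W beta1) c1 -> hardy a (W beta2) c2 ->
  hardy a (W beta) (t1 * c1 + t2 * c2).
Proof.
move=> t10 t20 t12 bE b0 b10 b20 h1 h2 u au.
have au1 := admissible_tilt beta1 au; have au2 := admissible_tilt beta2 au.
have := h2 _ au2; have := h1 _ au1.
have tiltE b : \int[mu]_(x in I) (tilt beta b u x ^+ 2 * W b x) =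
    \int[mu]_(x in I) (u x ^+ 2 * W beta x).
  by apply: eq_Rintegral => y _; rewrite tilt_sqr.
rewrite !tiltE.
have ip1 := admissible_prim_integrable b10 au1.
have ip2 := admissible_prim_integrable b20 au2.
move=> i1 i2; rewrite mulrDl -!mulrA.
apply: le_trans (lerD (ler_wpM2l t10 i1) (ler_wpM2l t20 i2)).
rewrite -!RintegralZl// -RintegralD//; [|exact: integrableZl_EFin..].
apply: le_Rintegral => //.
- exact: admissible_prim_integrable.
- by apply: integrableD_EFin => //; exact: integrableZl_EFin.
move=> x xI; have hx := prim_tilt_convex t10 t20 t12 bE b0 b10 b20 au xI.
have x0 : 0 <= x by move: xI; rewrite /= in_itv/= => /andP[/ltW].
have p0 : 0 <= prim u x * W (beta / 2) x.
  rewrite mulr_ge0 ?expR_ge0// /prim x0 Rintegral_ge0// => y _.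
  by case: au.
have := sqr_le_convex t10 t20 t12 p0 hx.
by rewrite !exprMn !gibbs_weight_sqr.
Qed.

(** The left-hand side of the Hardy inequality is positive for a test function
that is positive everywhere; the one used here is u = 1 / sqrt W. *)
Lemma hardy_gt0 beta c : 0 <= beta -> hardy a (W beta) c -> 0 < c.
Proof.
move=> b0 h.
have a1 : admissible a (W 0) (cst 1).
  split=> //; apply: (@bounded_itv_integrable _ _ _ _ _ 1).
    have -> : (fun y => cst 1 y ^+ 2 * W 0 y) = cst 1; last by [].
    by apply/funext => z; rewrite /gibbs_weight expr1n mul1r oppr0 mul0r expR0.
  by move=> z _; rewrite /gibbs_weight expr1n mul1r oppr0 mul0r expR0 normr1.
have au := admissible_tilt beta a1.
have lt0 : 0 < \int[mu]_(x in I) (prim (tilt 0 beta (cst 1)) x ^+ 2 * W beta x).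
  apply: Rintegral_itv_gt0 => //; first exact: (admissible_prim_integrable b0 au).
  move=> x xI; rewrite mulr_gt0 ?expR_gt0// exprn_gt0//.
  have /andP[x0 _] : 0 < x < a by move: xI; rewrite in_itv.
  rewrite /prim (ltW x0) Rintegral_itv_gt0//.
    exact: (admissible_integrable b0 au).
  by move=> z _; rewrite /tilt mul1r expR_gt0.
have := lt_le_trans lt0 (h _ au).
apply: contraTT; rewrite -!leNgt => c0; rewrite mulr_le0_ge0//.
by apply: Rintegral_ge0 => x _; rewrite mulr_ge0 ?sqr_ge0 ?expR_ge0.
Qed.

(** For each u the inequality is closed in c, so the infimum of the valid
constants is one of them. *)
Lemma best_hardy beta : 0 <= beta -> exists A, [/\ 0 < A, hardy a (W beta) A &
  forall c, hardy a (W beta) c -> A <= c].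
Proof.
move=> b0.
have hE : hardy a (W beta) (a * (a + 0 * a)).
  apply: hardy_of_kernel => //; first exact: ltW.
  by move=> x y *; exfalso; lra.
pose S := [set c | hardy a (W beta) c].
have S0 : has_inf S.
  split; first by exists (a * (a + 0 * a)).
  by exists 0 => c /hardy_gt0 => /(_ b0)/ltW.
have hinf : hardy a (W beta) (inf S).
  move=> u au; set N := \int[mu]_(x in I) (u x ^+ 2 * W beta x).
  have N0 : 0 <= N.
    by apply: Rintegral_ge0 => x _; rewrite mulr_ge0 ?sqr_ge0 ?expR_ge0.
  apply/ler_addgt0Pr => e e0.
  (* The 1 in e / (N + 1) avoids a division by zero when N = 0. *)
  have [c Sc cS] := inf_adherent (divr_gt0 e0 (ltr_wpDl N0 ltr01)) S0.
  apply: le_trans (Sc _ au) _.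
  rewrite -/N; apply: le_trans (ler_wpM2r N0 (ltW cS)) _.
  rewrite mulrDl lerD2l mulrAC ler_pdivrMr ?ltr_wpDl// ler_pM2l// lerDl ler01//.
exists (inf S); split => //; first exact: hardy_gt0 hinf.
by move=> c Sc; apply: ge_inf => //; case: S0.
Qed.

(** Some b3 > beta2 has A b3 <= A beta1 / 2.  By convexity A beta2 is at most
an average of A beta1 and A b3 with a positive weight on A b3, hence smaller
than A beta1. *)
Lemma best_hardy_lt (A : R -> R) :
  (forall beta, 0 <= beta -> [/\ 0 < A beta, hardy a (W beta) (A beta) &
     forall c, hardy a (W beta) c -> A beta <= c]) ->
  (forall e, 0 < e -> exists2 B, 0 <= B & forall b, B <= b -> A b <= e) ->
  forall beta1 beta2, 0 <= beta1 -> beta1 < beta2 -> A beta2 < A beta1.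
Proof.
move=> hA A0 b1 b2 b10 b12.
have [A1 h1 _] := hA _ b10.
have [B B0 hB] := A0 _ (divr_gt0 A1 (ltr0n _ 2)).
pose b3 := Num.max B (b2 + 1).
have b23 : b2 < b3 by rewrite lt_max ltrDl ltr01 orbT.
have b30 : 0 <= b3 by lra.
have b20 : 0 <= b2 by lra.
have A3 : A b3 <= A b1 / 2 by apply: hB; rewrite le_max lexx.
have [_ h3 _] := hA _ b30; have [_ _ m2] := hA _ b20.
have d0 : 0 < b3 - b1 by lra.
have := @hardy_convex b2 b1 b3 ((b3 - b2) / (b3 - b1)) ((b2 - b1) / (b3 - b1)) _ _
  _ _ _ _ b20 b10 b30 h1 h3.
move=> /(_ _ _ _ _)/m2.
have t2 : 0 < (b2 - b1) / (b3 - b1) by rewrite divr_gt0//; lra.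
have e : (b3 - b2) / (b3 - b1) = 1 - (b2 - b1) / (b3 - b1) by field; lra.
move=> h; apply: le_lt_trans (h _ _ _ _) _.
- by rewrite divr_ge0//; lra.
- exact: ltW.
- by rewrite e; ring.
- by field; lra.
- by rewrite e; nra.
Qed.

End hardy.

(** * Smooth bump functions *)

Section flat.
Context {R : realType}.
Implicit Types (P Q : {poly R}) (x t : R) (f g : R -> R).

(** The functions P(1/x) exp(-1/x) on x > 0, extended by 0, are smooth on the
line: the class is closed under differentiation and its members vanish to
second order at 0. *)
Definition flat P x := if 0 < x then P.[x^-1] * expR (- x^-1) else 0.

(** Monomial by monomial, t^i exp (- t) <= i! by the exponential series. *)
Lemma poly_expRN_bound Q : exists2 C, 0 <= C &
  forall t, 0 <= t -> `|Q.[t] * expR (- t)| <= C.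
Proof.
exists (\sum_(i < size Q) `|Q`_i| * i`!%:R).
  by apply: sumr_ge0 => i _; rewrite mulr_ge0.
move=> t t0; rewrite horner_coef mulr_suml.
apply: (le_trans (ler_norm_sum _ _ _)); apply: ler_sum => i _.
rewrite !normrM (ger0_norm (expR_ge0 _)) -mulrA ler_wpM2l//.
rewrite (ger0_norm (exprn_ge0 _ t0)) expRN ler_pdivrMr ?expR_gt0//.
case: (val i) => [|n]; first by rewrite expr0 fact0 mul1r -expR0 ler_expR.
have := expR_ge1Dxn n t0.
rewrite -ler_pdivrMl ?ltr0n ?fact_gt0// mulrC.
by apply: le_trans; rewrite lerDr.
Qed.

(** With t = 1/x, P(1/x) exp(-1/x) / x^2 is (t^2 P(t)) exp (- t), which is
bounded. *)
Lemma flat_quadratic P : exists2 C, 0 <= C & forall x, `|flat P x| <= C * x ^+ 2.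
Proof.
have [C C0 hC] := poly_expRN_bound (P * 'X^2).
exists C => // x; rewrite /flat; case: ifPn => [x0|_]; last first.
  by rewrite normr0 mulr_ge0 ?sqr_ge0.
have := hC x^-1; rewrite invr_ge0 => /(_ (ltW x0)).
rewrite hornerM hornerXn mulrAC normrM (ger0_norm (sqr_ge0 _)).
by rewrite exprVn ler_pdivrMr// exprn_gt0.
Qed.

Lemma is_derive_horner_expRN P t :
  is_derive t 1 (fun t => P.[t] * expR (- t)) ((P^`() - P).[t] * expR (- t)).
Proof.
have dE : is_derive t 1 (expR \o -%R) (expR (- t) * - 1).
  exact: is_derive1_comp.
apply: (is_derive_eq (is_deriveM (is_derive_poly P t) dE)).
by rewrite !hornerE /GRing.scale/=; ring.
Qed.

(** For x > 0 this is the chain rule with t = 1/x, whose derivative - t^2 gives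
the factor X^2; at 0 the derivative vanishes by [flat_quadratic]. *)
Lemma is_derive_flat P x : is_derive x 1 (flat P) (flat ('X^2 * (P - P^`())) x).
Proof.
have [x0|x0|<-] := ltgtP 0 x.
- have dV : is_derive x 1 (fun y : R => y^-1) (- (x ^- 2)).
    by apply: (is_derive_eq (is_deriveV _ (is_derive_id x 1)));
      rewrite ?gt_eqF// /GRing.scale/= mulr1.
  have dG := is_derive1_comp (is_derive_horner_expRN P x^-1) dV.
  rewrite /flat x0; apply: (@near_eq_is_derive _ _ _
    ((fun t => P.[t] * expR (- t)) \o (fun y : R => y^-1))); last first.
    by apply: (is_derive_eq dG); rewrite !hornerE exprVn; ring.
  by near=> y; rewrite /flat/= ifT//; near: y; exact: lt_nbhsr.
- have fx0 Q : flat Q x = 0 by rewrite /flat ltNge (ltW x0).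
  rewrite fx0.
  apply: (@near_eq_is_derive _ _ _ (cst 0)).
  near=> y; rewrite /flat/= ifF//; apply/negbTE; rewrite -leNgt ltW//.
  have : y \in `]-oo, 0[ by near: y; apply: near_in_itvNyo; rewrite in_itv.
  by rewrite in_itv.
- have f0 Q : flat Q 0 = 0 by rewrite /flat ltxx.
  have [C C0 hC] := flat_quadratic P.
  have h : h^-1 *: ((flat P \o shift 0) (h *: 1) - flat P 0) @[h --> 0^'] --> (0 : R).
    apply/cvgrPdist_le => /= e e0; near=> h.
    rewrite sub0r normrN f0 subr0 addr0 /GRing.scale/= mulr1 normrM normfV.
    have h0 : h != 0 by near: h; exact: nbhs_dnbhs_neq.
    rewrite mulrC ler_pdivrMr ?normr_gt0//; apply: le_trans (hC _) _.
    rewrite -(real_normK (num_real h)) expr2 mulrA ler_wpM2r//.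
    apply: (@le_trans _ _ ((C + 1) * `|h|)); first by rewrite ler_wpM2r// lerDl.
    rewrite -ler_pdivlMl ?ltr_wpDl// mulrC.
    by near: h; apply: dnbhs0_le; rewrite divr_gt0// ltr_wpDl.
  rewrite f0; apply: DeriveDef; first by apply/cvg_ex; exists 0.
  exact/cvg_lim.
Unshelve. all: by end_near. Qed.

(** A class of functions that contains the bumps and is closed under
differentiation, so that all its members are smooth.  Smoothness of products
would otherwise require a Leibniz formula for iterated derivatives. *)
Inductive flatalg : (R -> R) -> Prop :=
| flatalg_flat P c e : flatalg (fun x => flat P (c * x + e))
| flatalgZ k f : flatalg f -> flatalg (fun x => k * f x)
| flatalgD f g : flatalg f -> flatalg g -> flatalg (fun x => f x + g x)
| flatalgM f g : flatalg f -> flatalg g -> flatalg (fun x => f x * g x).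

Lemma flatalg_derive f : flatalg f ->
  exists2 g, flatalg g & forall x, is_derive x 1 f (g x).
Proof.
elim=> [P c e|k {}f _ [f' ff df]|{}f g _ [f' ff df] _ [g' gg dg]|
        {}f g hf [f' ff df] hg [g' gg dg]].
- exists (fun x => c * flat ('X^2 * (P - P^`())) (c * x + e)).
    exact/flatalgZ/flatalg_flat.
  move=> x; have dl : is_derive x 1 (fun x => c * x + e) c.
    apply: (is_derive_eq (is_deriveD (is_deriveZ c (is_derive_id x 1))
      (is_derive_cst e x 1))).
    by rewrite /GRing.scale/= mulr1 addr0.
  have := @is_derive1_comp _ (flat P) (fun x => c * x + e) x _ _ (is_derive_flat P (c * x + e)) dl.
  by rewrite mulrC.
- exists (fun x => k * f' x); first exact: flatalgZ.
  by move=> x; exact: is_deriveZ.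
- exists (fun x => f' x + g' x); first exact: flatalgD.
  by move=> x; exact: is_deriveD.
- exists (fun x => f x * g' x + g x * f' x).
    by apply: flatalgD; exact: flatalgM.
  by move=> x; exact: is_deriveM.
Qed.

Definition smooth (f : R -> R) := forall n x, derivable (derive1n n f) x 1.

Lemma flatalg_smooth f : flatalg f -> smooth f.
Proof.
move=> ff n; have : flatalg (derive1n n f).
  elim: n => [//|n /flatalg_derive[g gg dg]].
  rewrite derive1nS (_ : derive1 _ = g)//.
  by apply/funext => x; rewrite derive1E derive_val.
by move=> /flatalg_derive[g _ dg] x; have [] := dg x.
Qed.

Lemma smooth_primitive f g : (forall x, is_derive x 1 f (g x)) ->
  smooth g -> smooth f.
Proof.
move=> df sg [|n] x; first by have [] := df x.
rewrite derive1Sn (_ : derive1 f = g)//.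
by apply/funext => y; rewrite derive1E derive_val.
Qed.

Lemma smooth_continuous f : smooth f -> continuous f.
Proof.
by move=> sf x; apply/differentiable_continuous/derivable1_diffP/(sf 0).
Qed.

(** For c > 0 this is a smooth function supported in [p, q] with values in
[0, 1]; it tends to the indicator of ]p, q[ as c tends to infinity, since
exp (- 1 / (c z)) tends to 1 for z > 0. *)
Definition bump p q c x := flat 1 (c * (x - p)) * flat 1 (c * (q - x)).

Lemma flat1_itv x : 0 <= flat 1 x <= 1.
Proof.
rewrite /flat; case: ifPn => [x0|_]; last by rewrite lexx ler01.
by rewrite hornerC mul1r expR_ge0 -expR0 ler_expR oppr_le0 invr_ge0 ltW.
Qed.

Lemma bump_flatalg p q c : flatalg (bump p q c).
Proof.
rewrite /bump; apply: flatalgM.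
  have -> : (fun x => flat 1 (c * (x - p))) = (fun x => flat 1 (c * x + - (c * p))).
    by apply/funext => x; rewrite mulrBr.
  exact: flatalg_flat.
have -> : (fun x => flat 1 (c * (q - x))) = (fun x => flat 1 (- c * x + c * q)).
  by apply/funext => x; congr flat; ring.
exact: flatalg_flat.
Qed.

Lemma bump_itv p q c x : 0 <= bump p q c x <= 1.
Proof.
have /andP[? ?] := flat1_itv (c * (x - p)).
have /andP[? ?] := flat1_itv (c * (q - x)).
by rewrite /bump mulr_ge0//= mulr_ile1.
Qed.

Lemma bump_gt0 p q c x : 0 < c -> x \in `]p, q[ -> 0 < bump p q c x.
Proof.
move=> c0; rewrite in_itv/= => /andP[px xq].
have flat_gt0 z : 0 < z -> 0 < flat 1 z.
  by move=> z0; rewrite /flat z0 hornerC mul1r expR_gt0.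
by rewrite /bump mulr_gt0// flat_gt0// mulr_gt0// subr_gt0.
Qed.

Lemma bump_out p q c x : 0 <= c -> x \notin `]p, q[ -> bump p q c x = 0.
Proof.
move=> c0; rewrite in_itv/= negb_and -!leNgt => /orP[xp|qx].
  by rewrite /bump {1}/flat ifF ?mul0r// ltNge mulr_ge0_le0// subr_le0.
by rewrite /bump {2}/flat ifF ?mulr0// ltNge mulr_ge0_le0// subr_le0.
Qed.

Lemma bump_cvg p q x : bump p q n%:R x @[n --> \oo] --> (\1_`]p, q[ x : R).
Proof.
have flat_cvg z : 0 < z -> flat 1 (n%:R * z) @[n --> \oo] --> (1 : R).
  move=> z0; rewrite -(@cvg_shiftS _ _ ).
  have -> : (fun n => flat 1 (n.+1%:R * z)) = (fun n => expR (- (n.+1%:R^-1 * z^-1))).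
    by apply/funext => n; rewrite /flat ifT ?mulr_gt0// hornerC mul1r invfM.
  suff : expR (- (n.+1%:R^-1 * z^-1)) @[n --> \oo] --> expR (- (0 * z^-1)).
    by rewrite mul0r oppr0 expR0.
  apply: continuous_cvg; first exact: continuous_expR.
  by apply: (@cvgN _ R^o); apply: cvgMl; exact: cvg_harmonic.
rewrite indicE; have [xpq|xpq] := boolP (x \in `]p, q[).
  rewrite mem_set//= -[1%:R](mulr1 (1 : R)).
  move: xpq; rewrite in_itv/= => /andP[px xq].
  by apply: cvgM; apply: flat_cvg; rewrite subr_gt0.
rewrite memNset/=; last exact/negP.
by under eq_fun do rewrite bump_out//; exact: cvg_cst.
Qed.

End flat.

(** * Weak derivatives of primitives *)

Section swap.
Context {R : realType}.
Notation mu := (@lebesgue_measure R).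

(** Fubini's theorem for psi(x) g(y) on the half plane y <= x. *)
Lemma Rintegral_swap (g psi : R -> R) :
  mu.-integrable setT (EFin \o g) -> mu.-integrable setT (EFin \o psi) ->
  \int[mu]_x (psi x * \int[mu]_(y in `]-oo, x]) g y) =
  \int[mu]_y (g y * \int[mu]_(x in `[y, +oo[) psi x).
Proof.
move=> ig ip.
have mg : measurable_fun setT g by apply/measurable_EFinP; exact: measurable_int ig.
have mp : measurable_fun setT psi by apply/measurable_EFinP; exact: measurable_int ip.
pose A := [set z : measurableTypeR R * measurableTypeR R | z.2 <= z.1].
have mA : measurable A.
  rewrite -[A]setTI; apply: measurable_fun_le => //.
pose f (z : measurableTypeR R * measurableTypeR R) := (psi z.1 * g z.2 * \1_A z)%:E.
have mf : measurable_fun setT f.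
  apply/measurable_EFinP; apply: measurable_funM => //.
  by apply: measurable_funM; exact: measurableT_comp.
have fE (x y : R) : f (x, y) = (psi x * g y * (y <= x)%R%:R)%:E.
  by rewrite /f indicE; congr (_ * _)%:E; congr (_%:R); rewrite /A mem_setE.
have if_ : (mu \x mu)%E.-integrable setT f.
  apply/integrable12ltyP => //.
  apply: (@le_lt_trans _ _ (\int[mu]_x (`|psi x|%:E * \int[mu]_y `|g y|%:E)))%E.
    apply: ge0_le_integral => //.
    - by move=> x _; exact: integral_ge0.
    - apply: (measurable_fun_fubini_tonelli_F (abse \o f)) => //.
        exact: measurableT_comp.
      by move=> z; exact: abse_ge0.
    - apply: emeasurable_funM => //.
      by apply/measurable_EFinP; exact: measurableT_comp.
    - move=> x _; rewrite -ge0_integralZl//; last first.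
        by apply/measurable_EFinP; exact: measurableT_comp.
      apply: ge0_le_integral => //.
      + apply: measurableT_comp => //.
        exact: measurableT_comp mf (pair1_measurable x).
      + apply/measurable_EFinP; apply: measurable_funM => //.
        exact: measurableT_comp.
      + move=> y _; rewrite fE lee_fin !normrM ler_piMr ?mulr_ge0//.
        by case: (y <= x)%R; rewrite ?normr1 ?normr0.
  rewrite ge0_integralZr//=; last 2 first.
    by apply/measurable_EFinP; exact: measurableT_comp.
    exact: integral_ge0.
  apply: lte_mul_pinfty.
  - exact: integral_ge0.
  - have := integrable_lty measurableT (integrable_norm ip).
    by rewrite ge0_fin_numE//; exact: integral_ge0.
  - exact: integrable_lty (integrable_norm ig).
have := Fubini if_.
have -> : (\int[mu]_x \int[mu]_y f (x, y) =
    \int[mu]_x (psi x * \int[mu]_(y in `]-oo, x]) g y)%:E)%E.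
  apply: eq_integral => x _.
  have igx : mu.-integrable `]-oo, x] (EFin \o g) by exact: integrableS ig.
  rewrite EFinM EFin_Rintegral// -integralZl//.
  rewrite [RHS]integral_mkcond; apply: eq_integral => y _.
  rewrite fE patchE mem_setE in_itv/=; case: ifPn => yx; rewrite ?mulr1 ?mulr0//.
have -> : (\int[mu]_y \int[mu]_x f (x, y) =
    \int[mu]_y (g y * \int[mu]_(x in `[y, +oo[) psi x)%:E)%E.
  apply: eq_integral => y _.
  have ipy : mu.-integrable `[y, +oo[ (EFin \o psi) by exact: integrableS ip.
  rewrite EFinM EFin_Rintegral// -integralZl//.
  rewrite [RHS]integral_mkcond; apply: eq_integral => x _.
  rewrite fE patchE mem_setE in_itv/= andbT; case: ifPn => yx; rewrite ?mulr1 ?mulr0//.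
  by rewrite mulrC.
by rewrite /Rintegral => ->.
Qed.

End swap.

Section weak.
Context {R : realType}.
Notation mu := (@lebesgue_measure R).
Implicit Types (f g h phi : R -> R) (a b : R).

Lemma compact_sub_segment a (K : set R) : 0 < a -> compact K ->
  K `<=` `]- a, a[ -> exists b, 0 < b < a /\ forall x, K x -> `|x| < b.
Proof.
move=> a0 cK KU; have [K0|K0] := pselect (K !=set0); last first.
  exists (a / 2); split; first by apply/andP; split; lra.
  by move=> x Kx; exfalso; apply: K0; exists x.
have cn : {within K, continuous (@Num.norm R R)}.
  by apply: continuous_subspaceT => x; exact: norm_continuous.
have [c cK' cmax] := compact_EVT_max K0 cK cn.
have ca : `|c| < a.
  by have := KU _ (set_mem cK'); rewrite /= in_itv/= ltr_norml.
have c0 := normr_ge0 c.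
exists ((`|c| + a) / 2); split; first by apply/andP; split; lra.
by move=> x /mem_set/cmax xc; lra.
Qed.

Lemma locally_integrable_segment a g b : locally_integrable `]- a, a[ g ->
  b < a -> mu.-integrable `[- b, b] (EFin \o g).
Proof.
move=> [mg _ ig] ba.
have sub : `[- b, b]%classic `<=` `]- a, a[%classic.
  by move=> x; rewrite /= !in_itv/=; lra.
apply/integrableP; split.
  by apply/measurable_EFinP; exact: measurable_funS mg.
by apply: ig => //; exact: segment_compact.
Qed.

Lemma segment_locally_integrable a g : 0 < a -> measurable_fun `]- a, a[ g ->
  (forall b, b < a -> mu.-integrable `[- b, b] (EFin \o g)) ->
  locally_integrable `]- a, a[ g.
Proof.
move=> a0 mg ig; split=> // K KU cK; have [b [/andP[b0 ba] Kb]] := compact_sub_segment a0 cK KU.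
have /integrableP[mgb] := ig _ ba.
apply: le_lt_trans; apply: ge0_subset_integral => //.
- exact: compact_measurable.
- by apply/measurable_EFinP; apply: measurableT_comp => //; exact/measurable_EFinP.
- by move=> x /Kb; rewrite ltr_norml /= in_itv/= => /andP[? ?]; rewrite !ltW.
Qed.

(** The derivative vanishes off the support K too, as the complement of K is
open. *)
Lemma test_support a phi : 0 < a -> test_function `]- a, a[ phi ->
  exists b, 0 < b < a /\
    forall x, b <= `|x| -> phi x = 0 /\ derive1 phi x = 0.
Proof.
move=> a0 [_ [K [cK KU phi0]]].
have [b [ba Kb]] := compact_sub_segment a0 cK KU.
exists b; split=> // x bx; have nKx : ~ K x by move=> /Kb; rewrite ltNge bx.
split; first exact: phi0.
rewrite derive1E (@near_eq_derive _ _ _ _ (cst 0)) ?derive_cst//.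
have : open (~` K) by apply: closed_openC; exact: compact_closed.
by rewrite openE => /(_ x nKx); apply: filterS => y; exact: phi0.
Qed.

Lemma smooth_derive1 phi : smooth phi -> smooth (derive1 phi).
Proof. by move=> sp n x; rewrite -derive1Sn; exact: sp. Qed.

Lemma smooth_FTC phi (x y : R) : smooth phi -> x <= y ->
  mu.-integrable `[x, y] (EFin \o derive1 phi) /\
  \int[mu]_(z in `[x, y]) derive1 phi z = phi y - phi x.
Proof.
move=> sp xy; have cd := smooth_continuous (smooth_derive1 sp).
have cp := smooth_continuous sp.
have cdw : {within `[x, y], continuous (derive1 phi)} by exact: continuous_subspaceT.
split.
  by apply: continuous_compact_integrable => //; exact: segment_compact.
move: xy; rewrite le_eqVlt => /predU1P[->|xy].
  by rewrite set_itv1 Rintegral_set1 subrr.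
rewrite /Rintegral (@continuous_FTC2 _ _ phi)//.
split; [by move=> z _; exact: (sp 0)| |].
- by apply: cvg_at_right_filter; exact: cp.
- by apply: cvg_at_left_filter; exact: cp.
Qed.

Lemma continuous_bounded f (x y : R) : continuous f ->
  exists M, forall z, z \in `[x, y] -> `|f z| <= M.
Proof.
move=> cf; have cfw : {within `[x, y], continuous f} by exact: continuous_subspaceT.
have /compact_bounded[M [_ hM]] := continuous_compact cfw (@segment_compact _ x y).
exists (M + 1) => z zxy; apply: hM; first by rewrite ltrDl.
by exists z.
Qed.

(** Integration by parts with a merely integrable g: write prim g as an
integral from -b, where [-b, b] contains the support of phi, exchange the
integrals by Fubini, and integrate phi' from y to b by the fundamental theorem
of calculus; phi b = 0 gives the sign.  The constant due to the change of base
point disappears because phi' has integral 0. *)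
Lemma prim_weak_derivative a g : 0 < a -> locally_integrable `]- a, a[ g ->
  weak_derivative `]- a, a[ (prim g) g.
Proof.
move=> a0 lg; have ig b : b < a -> mu.-integrable `[- b, b] (EFin \o g).
  exact: locally_integrable_segment.
have cP b : b < a -> {within `[- b, b], continuous (prim g)}.
  move=> ba; apply/continuous_in_subspaceT => x; rewrite inE/= in_itv/= => xb.
  apply: (@prim_continuous _ g ((a + b) / 2)); first by apply: ig; lra.
  by rewrite in_itv/=; lra.
split=> //.
  apply: segment_locally_integrable => // [|b ba]; first exact: prim_measurable.
  apply: continuous_compact_integrable; last exact: cP.
  exact: segment_compact.
move=> phi tphi; have [b [/andP[b0 ba] phi0]] := test_support a0 tphi.
have sp : smooth phi by case: tphi.
have sub : `[- b, b]%classic `<=` `]- a, a[%classic.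
  by move=> x; rewrite /= !in_itv/=; lra.
have out x : ~ `[- b, b]%classic x -> phi x = 0 /\ derive1 phi x = 0.
  move=> /= xb; apply: phi0; rewrite leNgt; apply/negP => xb'; apply: xb.
  by rewrite in_itv/=; move: xb'; rewrite ltr_norml; lra.
rewrite (integral_support mu sub); last first.
  by move=> x _ /out[_ ->]; rewrite mulr0.
rewrite [in RHS](integral_support mu sub); last first.
  by move=> x _ /out[-> _]; rewrite mulr0.
have NJ : - b <= b by lra.
have cphi := smooth_continuous sp.
have cdphi := smooth_continuous (smooth_derive1 sp).
have phib : phi b = 0 by apply: (phi0 _ _).1; rewrite ger0_norm// ltW.
have phiNb : phi (- b) = 0 by apply: (phi0 _ _).1; rewrite normrN ger0_norm// ltW.
have [idphi intdphi] := smooth_FTC sp NJ.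
have iPd : mu.-integrable `[- b, b] (fun x => (prim g x * derive1 phi x)%:E).
  apply: continuous_compact_integrable; first exact: segment_compact.
  move=> x; apply: cvgM; first exact: cP.
  have cw : {within `[- b, b], continuous (derive1 phi)} by exact: continuous_subspaceT.
  exact: cw.
have igp : mu.-integrable `[- b, b] (fun x => (g x * phi x)%:E).
  have [M hM] := continuous_bounded (- b) b cphi.
  apply: (integrable_mul_bounded (M := M)) => //; first exact: ig.
  by apply: measurable_funTS; apply: continuous_measurable_fun.
rewrite -!EFin_Rintegral// -EFinN; congr EFin.
pose J := `[- b, b]%classic : set R.
have mJ : measurable J by exact: measurable_itv.
have igJ : mu.-integrable setT (EFin \o (g \_ J)).
  by rewrite -restrict_EFin; apply/integrable_restrict; rewrite ?setTI//; exact: ig.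
have idJ : mu.-integrable setT (EFin \o (derive1 phi \_ J)).
  by rewrite -restrict_EFin; apply/integrable_restrict; rewrite ?setTI.
have := Rintegral_swap igJ idJ.
have -> : \int[mu]_x ((derive1 phi \_ J) x * \int[mu]_(y in `]-oo, x]) (g \_ J) y) =
    \int[mu]_(x in J) (prim g x * derive1 phi x).
  transitivity (\int[mu]_(x in J) (prim g x * derive1 phi x +
      \int[mu]_(y in `[- b, 0]) g y * derive1 phi x)); last first.
    rewrite RintegralD//; last exact: integrableZl_EFin.
    by rewrite RintegralZl// intdphi phib phiNb subrr mulr0 addr0.
  rewrite [RHS]Rintegral_mkcond; apply: eq_Rintegral => x _.
  rewrite !patchE; case: ifPn => xJ; last by rewrite mul0r.
  rewrite -mulrDl mulrC; congr (_ * _).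
  have xb : x \in `[- b, b] by move: xJ; rewrite inE.
  rewrite (primE xb (ig _ ba)) subrK -Rintegral_mkcondr; congr (Rintegral mu _ g).
  move: xb; rewrite in_itv/= => xb; apply/seteqP; split => y; rewrite /J/= !in_itv/=; lra.
have -> : \int[mu]_y ((g \_ J) y * \int[mu]_(x in `[y, +oo[) (derive1 phi \_ J) x) =
    \int[mu]_(y in J) (- 1 * (g y * phi y)).
  rewrite [RHS]Rintegral_mkcond; apply: eq_Rintegral => y _.
  rewrite !patchE; case: ifPn => yJ; last by rewrite mul0r.
  have /andP[by_ yb] : - b <= y <= b by move: yJ; rewrite inE /J/= in_itv.
  rewrite -Rintegral_mkcondr (_ : _ `&` _ = `[y, b]%classic).
    by rewrite (smooth_FTC sp yb).2 phib sub0r mulrN mulN1r.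
  by apply/seteqP; split => z; rewrite /J/= !in_itv/=; lra.
by rewrite RintegralZl// mulN1r => ->.
Qed.

Lemma test_derive_integrable a f phi : 0 < a -> locally_integrable `]- a, a[ f ->
  test_function `]- a, a[ phi ->
  mu.-integrable `]- a, a[ (fun x => (f x * derive1 phi x)%:E).
Proof.
move=> a0 lf tphi; have [b [/andP[b0 ba] phi0]] := test_support a0 tphi.
have sp : smooth phi by case: tphi.
have cd := smooth_continuous (smooth_derive1 sp).
have sub : `[- b, b]%classic `<=` `]- a, a[%classic.
  by move=> x; rewrite /= !in_itv/=; lra.
apply: (@integrable_support _ _ _ mu _ `[- b, b]) => //.
  move=> x _ /= xb; rewrite (phi0 x _).2 ?mulr0// leNgt; apply/negP => xb'; apply: xb.
  by rewrite in_itv/=; move: xb'; rewrite ltr_norml; lra.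
have [M hM] := continuous_bounded (- b) b cd.
apply: (integrable_mul_bounded (M := M)) => //.
  exact: locally_integrable_segment lf ba.
by apply: measurable_funTS; apply: continuous_measurable_fun.
Qed.

End weak.

(** * The lemma of du Bois-Reymond *)

Section du_bois_reymond.
Context {R : realType}.
Notation mu := (@lebesgue_measure R).
Implicit Types (f g h phi psi : R -> R) (a b : R).

Lemma supported_integrable psi b : continuous psi ->
  (forall x, ~ `[- b, b]%classic x -> psi x = 0) ->
  mu.-integrable setT (EFin \o psi).
Proof.
move=> cpsi out; have -> : psi = psi \_ `[- b, b].
  by apply/funext => x; rewrite patchE; case: ifPn => //; rewrite notin_setE => /out.
rewrite -restrict_EFin; apply/integrable_restrict; rewrite ?setTI//.
apply: continuous_compact_integrable; first exact: segment_compact.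
exact: continuous_subspaceT.
Qed.

(** The primitive from -oo is smooth; it vanishes to the left of the support,
and also to its right because psi has mean zero. *)
Lemma test_primitive a b psi : 0 < b < a -> smooth psi ->
  (forall x, ~ `[- b, b]%classic x -> psi x = 0) ->
  \int[mu]_x psi x = 0 ->
  exists2 phi, test_function `]- a, a[ phi & derive1 phi = psi.
Proof.
move=> /andP[b0 ba] sp out p0; have cpsi := smooth_continuous sp.
have ipsi := supported_integrable cpsi out.
pose phi x := \int[mu]_(t in `]-oo, x]) psi t.
have dphi (x : R) : is_derive x 1 phi (psi x).
  have ip : mu.-integrable `]-oo, (x + 1)] (EFin \o psi) by exact: integrableS ipsi.
  have [|d1 d2] := @continuous_FTC1 _ psi (BInfty _ true) x _ _ ip (ltNyr _) (cpsi x).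
    by rewrite ltrDl.
  apply: (@DeriveDef _ _ _ _ _ phi _ d1); rewrite -derive1E; exact: d2.
exists phi; last by apply/funext => x; rewrite derive1E derive_val.
split; first exact: smooth_primitive sp.
exists (`[- b, b]%classic); split; first exact: segment_compact.
  by move=> x; rewrite /= !in_itv/=; lra.
move=> x; rewrite /= in_itv/= => /negP; rewrite negb_and -!ltNge => /orP[xb|bx].
  rewrite /phi (@eq_Rintegral _ _ _ _ _ (cst 0)); first by rewrite Rintegral_cst// mul0r.
  move=> y; rewrite inE/= in_itv/= => yx; apply: out.
  by rewrite /= in_itv/=; lra.
rewrite -p0 /phi Rintegral_mkcond; apply: eq_Rintegral => y _.
rewrite patchE; case: ifPn => //; rewrite notin_setE/= in_itv/= => /negP.
by rewrite -ltNge => xy; rewrite out//= in_itv/=; lra.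
Qed.

(** Subtracting from a bump the multiple of a fixed bump that has the same
integral leaves a function of mean zero, hence the derivative of a test
function, to which h is orthogonal.  So the integral of h against any bump is
C times the integral of that bump, where C is the average of h against the
fixed bump. *)
Lemma orthogonal_bump_mean a h : 0 < a -> locally_integrable `]- a, a[ h ->
  (forall phi, test_function `]- a, a[ phi ->
    \int[mu]_(x in `]- a, a[) (h x * derive1 phi x) = 0) ->
  exists C, forall p q (n : nat), - a < p -> q < a ->
    \int[mu]_(x in `]- a, a[) ((h x - C) * bump p q n%:R x) = 0.
Proof.
move=> a0 lh orth.
have cbump p q c : continuous (bump p q c : R -> R).
  exact: smooth_continuous (flatalg_smooth (bump_flatalg p q c)).
have bout p q c b x : 0 <= c -> - b <= p -> q <= b -> ~ `[- b, b]%classic x ->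
    bump p q c x = 0.
  move=> c0 bp qb /= xb; apply: bump_out => //; apply: contra_notN xb.
  by rewrite !in_itv/=; lra.
pose bump0 : R -> R := bump (- (a / 2)) (a / 2) 1.
have ibump p q c : 0 <= c -> mu.-integrable setT (EFin \o bump p q c).
  move=> c0; pose b := Num.max (- p) q.
  apply: (@supported_integrable _ b) => // x; apply: bout => //.
    by rewrite lerNl le_max lexx.
  by rewrite le_max lexx orbT.
have hib p q c : 0 <= c -> - a < p -> q < a ->
    mu.-integrable `]- a, a[ (fun x => (h x * bump p q c x)%:E).
  move=> c0 ap qa; pose b := Num.max (- p) q.
  have ba : b < a by rewrite gt_max; apply/andP; split; lra.
  have bp : - b <= p by rewrite lerNl le_max lexx.
  have qb : q <= b by rewrite le_max lexx orbT.
  have sub : `[- b, b]%classic `<=` `]- a, a[%classic.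
    by move=> x; rewrite /= !in_itv/=; lra.
  have : mu.-integrable `[- b, b] (fun x => (h x * bump p q c x)%:E).
    apply: (@integrable_mul_bounded _ _ _ _ _ _ _ 1) => //.
    - exact: locally_integrable_segment lh ba.
    - by apply: measurable_funTS; apply: continuous_measurable_fun.
    - by move=> x _; have /andP[? ?] := bump_itv p q c x; rewrite ger0_norm.
  apply: integrable_support => // x _ xb.
  by rewrite (bout _ _ _ b) ?mulr0.
have I0 : 0 < \int[mu]_x bump0 x.
  have -> : \int[mu]_x bump0 x = \int[mu]_(x in `]- (a / 2), a / 2[) bump0 x.
    rewrite [RHS]Rintegral_mkcond; apply: eq_Rintegral => x _.
    by rewrite patchE mem_setE; case: ifPn => // xn; rewrite /bump0 bump_out.
  apply: Rintegral_itv_gt0; first lra.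
    by apply: (@integrableS _ _ _ _ setT) => //; exact: ibump.
  by move=> z zI; exact: bump_gt0.
pose C := \int[mu]_(x in `]- a, a[) (h x * bump0 x) / \int[mu]_x bump0 x.
exists C => p q n ap qa.
pose k := \int[mu]_x bump p q n%:R x / \int[mu]_x bump0 x.
pose psi x := bump p q n%:R x + (- k) * bump0 x.
have fpsi : flatalg psi.
  by apply: flatalgD; [exact: bump_flatalg|apply: flatalgZ; exact: bump_flatalg].
pose b := Num.max (a / 2) (Num.max (- p) q).
have b0 : 0 < b by rewrite lt_max; apply/orP; left; lra.
have ba : b < a by rewrite !gt_max; apply/and3P; split; lra.
have bp : - b <= p by rewrite lerNl !le_max lexx orbT.
have qb : q <= b by rewrite !le_max lexx !orbT.
have ab : a / 2 <= b by rewrite le_max lexx.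
have out x : ~ `[- b, b]%classic x -> psi x = 0.
  by move=> xb; rewrite /psi /bump0 !(bout _ _ _ b)// ?mulr0 ?addr0//; lra.
have int0 : \int[mu]_x psi x = 0.
  rewrite /psi RintegralD//; [|exact: ibump|apply: integrableZl_EFin => //; exact: ibump].
  rewrite RintegralZl//; last exact: ibump.
  by rewrite mulNr /k divfK ?subrr// gt_eqF.
have [|phi tphi phiE] := @test_primitive a b psi _ (flatalg_smooth fpsi) out int0.
  by rewrite b0.
have := orth _ tphi; rewrite phiE /psi.
have hb := hib p q n%:R (ler0n _ _) ap qa.
have hb0 : mu.-integrable `]- a, a[ (fun x => (h x * bump0 x)%:E).
  by apply: hib => //; lra.
have -> : \int[mu]_(x in `]- a, a[) (h x * (bump p q n%:R x + - k * bump0 x)) =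
    \int[mu]_(x in `]- a, a[) (h x * bump p q n%:R x) - k *
    \int[mu]_(x in `]- a, a[) (h x * bump0 x).
  rewrite -RintegralZl// -RintegralB//; last exact: integrableZl_EFin.
  by apply: eq_Rintegral => x _; ring.
move=> e; transitivity (\int[mu]_(x in `]- a, a[) (h x * bump p q n%:R x) -
    C * \int[mu]_(x in `]- a, a[) bump p q n%:R x).
  rewrite -RintegralZl//; last by apply: (@integrableS _ _ _ _ setT) => //; exact: ibump.
  rewrite -RintegralB//; first by apply: eq_Rintegral => x _; ring.
  apply: integrableZl_EFin => //.
  by apply: (@integrableS _ _ _ _ setT) => //; exact: ibump.
have -> : \int[mu]_(x in `]- a, a[) bump p q n%:R x = \int[mu]_x bump p q n%:R x.
  rewrite Rintegral_mkcond; apply: eq_Rintegral => x _; rewrite patchE.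
  case: ifPn => //; rewrite notin_setE/= in_itv/= => xa; rewrite bump_out//.
  by rewrite in_itv/=; apply: contra_notN xa; lra.
by rewrite -[RHS]e /C /k; congr (_ - _); rewrite mulrAC -mulrA mulrC.
Qed.

(** Dominated convergence, since bumps take their values in [0, 1]. *)
Lemma integral_bump_cvg (p q : R) h : mu.-integrable `]p, q[ (EFin \o h) ->
  (\int[mu]_(x in `]p, q[) (h x * bump p q n%:R x)%:E)%E @[n --> \oo] -->
  (\int[mu]_(x in `]p, q[) (h x)%:E)%E.
Proof.
move=> ih; have mh : measurable_fun `]p, q[ h.
  by apply/measurable_EFinP; exact: measurable_int ih.
have mb c : measurable_fun `]p, q[ (bump p q c).
  apply: measurable_funTS; apply: continuous_measurable_fun.
  exact: smooth_continuous (flatalg_smooth (bump_flatalg p q c)).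
have h1 n : measurable_fun `]p, q[ (fun x => (h x * bump p q n%:R x)%:E).
  by apply/measurable_EFinP; exact: measurable_funM.
have h2 : measurable_fun `]p, q[ (EFin \o h) by exact/measurable_EFinP.
have h3 : {ae mu, forall x, `]p, q[%classic x ->
    (h x * bump p q n%:R x)%:E @[n --> \oo] --> (EFin \o h) x}.
  apply: aeW => x xpq /=; apply: cvg_EFin; first exact: nearW.
  rewrite -[X in _ --> X](mulr1 (h x)); apply: cvgM; first exact: cvg_cst.
  by have := @bump_cvg R p q x; rewrite indicE mem_set.
have h4 : {ae mu, forall x n, `]p, q[%classic x ->
    (`|(h x * bump p q n%:R x)%:E| <= `|h x|%:E)%E}.
  apply: aeW => x n _; rewrite lee_fin normrM ler_piMr//.
  by have /andP[? ?] := bump_itv p q n%:R x; rewrite ger0_norm.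
by have [_ _] := @dominated_convergence _ _ _ mu _ (measurable_itv _) _ _ _
  h1 h2 h3 (integrable_norm ih) h4.
Qed.

(** Lebesgue differentiation: almost everywhere, h is the derivative of its
indefinite integral from -b, which is locally constant. *)
Lemma zero_of_integrals (b : R) h : mu.-integrable `[- b, b] (EFin \o h) ->
  (forall q, - b < q -> q < b -> \int[mu]_(x in `]- b, q[) h x = 0) ->
  {ae mu, forall x, x \in `]- b, b[ -> h x = 0}.
Proof.
move=> ih h0; pose k := h \_ `[- b, b].
have ik : mu.-integrable setT (EFin \o k).
  by rewrite /k -restrict_EFin; apply/integrable_restrict; rewrite ?setTI.
have lk : locally_integrable setT k by apply: open_integrable_locally => //; exact: openT.
have iky y : mu.-integrable `]- b, y] (EFin \o k) by exact: integrableS ik.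
(* The differentiation theorem is applied to the extension by 0 of h. *)
have := @FTC1 R k (BRight (- b)) iky lk.
apply: filterS; first exact: (ae_filter_ringOfSetsType mu).
move=> x + xb; have /andP[bx xb'] : - b < x < b by move: xb; rewrite in_itv.
rewrite lte_fin => /(_ bx)[_].
rewrite derive1E (@near_eq_derive _ _ _ _ (cst 0)) ?derive_cst//.
  by move=> ->; rewrite /k patchE mem_set//= in_itv/= !ltW.
near=> y; have : y \in `]- b, b[ by near: y; exact: near_in_itvoo.
rewrite in_itv/= => /andP[by_ yb].
transitivity (\int[mu]_(t in `]- b, y]) h t).
  apply: eq_Rintegral => t; rewrite inE/= in_itv/= => /andP[t1 t2].
  by rewrite /k patchE mem_set//= in_itv/=; lra.
rewrite -Rintegral_itv_bndo_bndc ?h0//.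
apply: integrableS ih => // t; rewrite /= !in_itv/=; lra.
Unshelve. all: by end_near. Qed.

(** Letting the bumps increase to indicators shows that h - C has integral 0
over every ]p, q[ with closure inside ]-a, a[, hence vanishes almost
everywhere. *)
Lemma du_bois_reymond a h : 0 < a -> locally_integrable `]- a, a[ h ->
  (forall phi, test_function `]- a, a[ phi ->
    \int[mu]_(x in `]- a, a[) (h x * derive1 phi x) = 0) ->
  exists C, {ae mu, forall x, x \in `]- a, a[ -> h x = C}.
Proof.
move=> a0 lh /(orthogonal_bump_mean a0 lh)[C hC]; exists C.
have ik b : b < a -> mu.-integrable `[- b, b] (fun x => (h x - C)%:E).
  move=> ba; apply: integrableB_EFin => //.
    exact: locally_integrable_segment lh ba.
  by apply: (@bounded_itv_integrable _ _ _ _ _ `|C|).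
have int0 p q : - a < p -> q < a -> \int[mu]_(x in `]p, q[) (h x - C) = 0.
  move=> ap qa; pose b := Num.max (- p) q.
  have ba : b < a by rewrite gt_max; apply/andP; split; lra.
  have bp : - b <= p by rewrite lerNl le_max lexx.
  have qb : q <= b by rewrite le_max lexx orbT.
  have ipq : mu.-integrable `]p, q[ (EFin \o (fun x => h x - C)).
    apply: integrableS (ik _ ba) => // t; rewrite /= !in_itv/=; lra.
  have e n : (\int[mu]_(x in `]p, q[) ((h x - C) * bump p q n%:R x)%:E = 0)%E.
    rewrite -EFin_Rintegral//; last first.
      apply: (@integrable_mul_bounded _ _ _ _ _ _ _ 1) => //.
        apply: measurable_funTS; apply: continuous_measurable_fun.
        exact: smooth_continuous (flatalg_smooth (bump_flatalg p q n%:R)).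
      by move=> x _; have /andP[? ?] := bump_itv p q n%:R x; rewrite ger0_norm.
    congr EFin; rewrite -(hC p q n ap qa) /Rintegral; congr fine.
    apply/esym/integral_support; first by move=> t; rewrite /= !in_itv/=; lra.
    by move=> t _ tpq; rewrite bump_out ?mulr0//; apply/negP.
  have := integral_bump_cvg ipq; rewrite (eq_cvg _ _ e) => c0.
  by rewrite /Rintegral (cvg_unique _ c0 (cvg_cst 0%E)).
(* ]-a, a[ is exhausted by a sequence, as only countably many exceptional sets
   can be united. *)
pose b n := a - a / n.+1%:R.
have ba n : b n < a by rewrite /b ltrBlDr ltrDl divr_gt0.
have : {ae mu, forall x, forall n, x \in `]- b n, b n[ -> h x - C = 0}.
  apply: ae_foralln => n; apply: zero_of_integrals; first exact: ik.
  by move=> q bq qb; apply: int0; have := ba n; lra.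
apply: filterS; first exact: (ae_filter_ringOfSetsType mu).
move=> x hx xa; apply/eqP; rewrite -subr_eq0; apply/eqP.
have xa' : `|x| < a by move: xa; rewrite in_itv/= ltr_norml.
pose n := Num.truncn (a / (a - `|x|)).
apply: (hx n); rewrite in_itv/= -ltr_norml /b ltrBrDr -ltrBrDl ltr_pdivrMr//.
by rewrite mulrC -ltr_pdivrMr ?subr_gt0// truncnS_gt.
Qed.

End du_bois_reymond.

(** * Reflection across the origin *)

Section reflection.
Context {R : realType}.
Notation mu := (@lebesgue_measure R).
Implicit Types (D : set R) (f g : R -> R) (a b x : R).

(* Negation as a map of the measurable space that carries the Lebesgue
   measure, so that pushforward lemmas apply to it. *)
Local Notation opp := (-%R : measurableTypeR R -> measurableTypeR R).

Lemma measurable_fun_oppr D f : measurable D -> measurable_fun D f ->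
  measurable_fun (opp @^-1` D) (fun x => f (- x)).
Proof.
move=> mD mf; by apply: (measurable_comp mD) => // _ [x Dx <-].
Qed.

(** Lebesgue measure is its own pushforward under negation. *)
Lemma ge0_integral_oppr D (F : R -> \bar R) : measurable D ->
  measurable_fun D F -> (forall x, D x -> (0 <= F x)%E) ->
  (\int[mu]_(x in D) F x = \int[mu]_(x in opp @^-1` D) F (- x)%R)%E.
Proof.
move=> mD mF F0; rewrite -(@ge0_integral_pushforward _ _ _ _ _ opp _ mu D F)//.
  by apply: eq_measure_integral => A mA AD; exact/esym/lebesgue_measureN.
by move=> x /set_mem/F0.
Qed.

Lemma integral_oppr D (F : R -> \bar R) : measurable D -> measurable_fun D F ->
  (\int[mu]_(x in D) F x = \int[mu]_(x in opp @^-1` D) F (- x)%R)%E.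
Proof.
move=> mD mF; rewrite integralE [RHS]integralE.
congr (_ - _)%E.
- rewrite ge0_integral_oppr//; last exact: measurable_funepos.
  by apply: eq_integral => x _; rewrite (funepos_comp F (-%R : R -> R)).
- rewrite ge0_integral_oppr//; last exact: measurable_funeneg.
  by apply: eq_integral => x _; rewrite (funeneg_comp F (-%R : R -> R)).
Qed.

Lemma integrable_oppr D f : measurable D -> mu.-integrable D (EFin \o f) ->
  mu.-integrable (opp @^-1` D) (fun x => (f (- x))%:E).
Proof.
move=> mD /integrableP[mf iF]; apply/integrableP; split.
  by apply/measurable_EFinP; apply: measurable_fun_oppr => //; exact/measurable_EFinP.
move: iF; rewrite ge0_integral_oppr//.
exact: measurableT_comp.
Qed.

Lemma Rintegral_oppr D f : measurable D -> measurable_fun D f ->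
  \int[mu]_(x in D) f x = \int[mu]_(x in opp @^-1` D) f (- x).
Proof.
by move=> mD mf; rewrite /Rintegral integral_oppr//; exact/measurable_EFinP.
Qed.

Lemma oppr_preimage_itv (b1 b2 : bool) x y :
  opp @^-1` [set` Interval (BSide b1 x) (BSide b2 y)] =
  [set` Interval (BSide (~~ b2) (- y)) (BSide (~~ b1) (- x))].
Proof. by rewrite opp_preimage_itvbndbnd. Qed.

(** Reflection exchanges the two half-open intervals in the definition of
[prim], up to one end point, which is negligible. *)
Lemma prim_oppr g b x : mu.-integrable `[- b, b] (EFin \o g) -> x \in `]0, b] ->
  prim (fun y => g (- y)) x = - prim g (- x).
Proof.
rewrite in_itv/= => ig /andP[x0 xb].
rewrite /prim (ltW x0) leNgt oppr_lt0 x0/= opprK.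
have mg : measurable_fun `]- x, 0] g.
  apply/measurable_EFinP; apply: measurable_funS (measurable_int _ ig) => // y.
  by rewrite /= !in_itv/=; lra.
rewrite [RHS]Rintegral_oppr// oppr_preimage_itv/= oppr0 opprK.
have ig' : mu.-integrable `]- x, 0[ (EFin \o g).
  by apply: integrableS ig => // y; rewrite /= !in_itv/=; lra.
have := integrable_oppr (measurable_itv _) ig'; rewrite oppr_preimage_itv/= oppr0 opprK => igN.
by rewrite -Rintegral_itv_obnd_cbnd// -Rintegral_itv_bndo_bndc.
Qed.

Lemma half_split a : 0 < a ->
  `]- a, a[%classic = (`]- a, 0[ `|` ([set 0] `|` `]0, a[))%classic.
Proof.
move=> a0; apply/seteqP; split => x /=; rewrite !in_itv/=.
  move=> /andP[ax xa]; have [x0|x0|x0] := ltgtP x 0.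
  - by left; rewrite ax.
  - by right; right; rewrite xa.
  - by right; left.
by case=> [|[->|]]; lra.
Qed.

Lemma integrable_halves a f : 0 < a ->
  mu.-integrable `]0, a[ (EFin \o f) ->
  mu.-integrable `]0, a[ (fun x => (f (- x))%:E) ->
  mu.-integrable `]- a, a[ (EFin \o f).
Proof.
move=> a0 if1 /(integrable_oppr (measurable_itv _)).
rewrite oppr_preimage_itv/= oppr0 => if2.
rewrite half_split//; apply: integrable_union => //; first exact: measurableU.
  by apply: eq_integrable if2 => // x _; rewrite opprK.
apply: integrable_union => //.
apply: null_set_integrable; first exact: measurable_set1.
  exact: measurable_fun_set1.
exact: lebesgue_measure_set1.
Qed.

Lemma Rintegral_halves a f : 0 < a -> mu.-integrable `]- a, a[ (EFin \o f) ->
  \int[mu]_(x in `]- a, a[) f x =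
  \int[mu]_(x in `]0, a[) f (- x) + \int[mu]_(x in `]0, a[) f x.
Proof.
move=> a0 if_; have m0 : measurable ([set 0] `|` `]0, a[%classic : set R).
  exact: measurableU.
have sub1 : `]- a, 0[%classic `<=` `]- a, a[%classic.
  by move=> x; rewrite /= !in_itv/=; lra.
have sub2 : [set 0] `|` `]0, a[%classic `<=` `]- a, a[%classic.
  by rewrite [X in _ `<=` X]half_split// => x; right.
have if1 := @integrableS _ _ _ mu _ _ _ (measurable_itv _) (measurable_itv _) sub1 if_.
have if2 := @integrableS _ _ _ mu _ _ _ (measurable_itv _) m0 sub2 if_.
rewrite half_split// Rintegral_setU//; last 2 first.
  by rewrite -half_split.
  by apply/disj_setPS => x [] /=; rewrite !in_itv/= => ? [?|?]; lra.
congr (_ + _).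
  rewrite Rintegral_oppr//; last by apply/measurable_EFinP; exact: measurable_int if1.
  by rewrite oppr_preimage_itv/= oppr0 opprK.
rewrite Rintegral_setU// ?Rintegral_set1 ?add0r//.
by apply/disj_setPS => x [] /= ->; rewrite in_itv/= ltxx.
Qed.

End reflection.

(** * Integration against a density *)

Section real_display.
Context {R : realType}.

(** The real line carries two measurable structures with the same measurable
sets, the canonical one and the one on which Lebesgue measure is defined.  An
integral for one is an integral for the other because the identity between
them is measurable and pushes m forward to itself. *)
Lemma ge0_integral_realE (m : {measure set (measurableTypeR R) -> \bar R})
    (D : set R) (F : R -> \bar R) :
  measurable D -> measurable_fun D F -> (forall x, D x -> (0 <= F x)%E) ->
  (\int[(m : set R -> \bar R)]_(x in D) F x = \int[m]_(x in D) F x)%E.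
Proof.
move=> mD mF F0.
have mid : measurable_fun [set: measurableTypeR R] (id : measurableTypeR R -> R).
  exact: measurable_id.
rewrite -(ge0_integral_pushforward mid m mD mF)//.
by move=> x /set_mem/F0.
Qed.

Lemma integral_realE (m : {measure set (measurableTypeR R) -> \bar R})
    (D : set R) (F : R -> \bar R) : measurable D -> measurable_fun D F ->
  (\int[(m : set R -> \bar R)]_(x in D) F x = \int[m]_(x in D) F x)%E.
Proof.
move=> mD mF.
transitivity (\int[pushforward m (id : measurableTypeR R -> R)]_(x in D) F x)%E.
  by [].
rewrite integralE [RHS]integralE.
by congr (_ - _)%E; apply: ge0_integral_realE => //;
  [exact: measurable_funepos|exact: measurable_funeneg].
Qed.

End real_display.

Section density.
Context {R : realType}.
Notation mu := (@lebesgue_measure R).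
Variables (U : set R) (w : R -> R).
Implicit Types (f : R -> R) (F : R -> \bar R).
Hypothesis mU : measurable U.
Hypothesis w0 : forall x, U x -> 0 <= w x.
Hypothesis iw : mu.-integrable U (EFin \o w).

(** The type of V is the measurable space of the Lebesgue measure, on which the
Radon-Nikodym theorem can compare the two measures. *)
Definition density (V : set (measurableTypeR R)) : \bar R :=
  (\int[mu]_(x in V `&` U) (w x)%:E)%E.

Let mw : measurable_fun U w.
Proof. by apply/measurable_EFinP; exact: measurable_int iw. Qed.

Let density0 : density set0 = 0%E.
Proof. by rewrite /density set0I integral_set0. Qed.

Let density_ge0 A : (0 <= density A)%E.
Proof. by apply: integral_ge0 => x [_ Ux]; rewrite lee_fin w0. Qed.

Let density_sigma_additive : semi_sigma_additive density.
Proof.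
move=> A mA tA mUA; rewrite /density setI_bigcupl integral_bigcup//.
- by apply: is_cvg_ereal_nneg_natsum_cond => n _ _; exact: density_ge0.
- exact: trivIset_setIr.
- by move=> n; exact: measurableI.
- apply: integrableS iw => //; first by apply: bigcup_measurable => n _; exact: measurableI.
  by move=> x [n _ []].
Qed.

HB.instance Definition _ := isMeasure.Build _ _ _
  density density0 density_ge0 density_sigma_additive.

Let density_fin : fin_num_fun density.
Proof.
move=> A mA; apply: integrable_fin_num; first exact: measurableI.
by apply: integrableS iw => //; exact: measurableI.
Qed.

HB.instance Definition _ := Measure_isFinite.Build _ _ _ density density_fin.

Let density_dominates : density `<< mu.
Proof.
apply/null_content_dominatesP => A mA muA0; apply: null_set_integral.
- exact: measurableI.
- by apply/measurable_EFinP; apply: measurable_funS mw => //; exact: subIsetr.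
- by apply: (subset_measure0 _ mA _ muA0) => //; exact: measurableI.
Qed.

(* Change of variables is available for the Radon-Nikodym derivative; that
   derivative is w almost everywhere, since both have the same integral over
   every measurable subset of U. *)
Let ge0_integral_density0 F : measurable_fun U F ->
  (forall x, U x -> (0 <= F x)%E) ->
  (\int[density]_(x in U) F x = \int[mu]_(x in U) (F x * (w x)%:E))%E.
Proof.
move=> mF F0.
transitivity (\int[density]_(x in U) ((F \_ U) x))%E.
  by apply: eq_integral => x xU; rewrite patchE xU.
rewrite -(Radon_Nikodym_SigmaFinite.change_of_variables density_dominates)//; last 2 first.
- by move=> x; rewrite patchE; case: ifPn => // /set_mem/F0.
- by apply: (eq_measurable_fun F) => // x xU; rewrite patchE xU.
set rn := Radon_Nikodym_SigmaFinite.f _ _.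
have irn : mu.-integrable setT rn.
  exact: (Radon_Nikodym_SigmaFinite.f_integrable density_dominates).
have irnU : mu.-integrable U rn by apply: integrableS irn.
apply: ae_eq_integral => //.
- apply: emeasurable_funM; last exact: measurable_int irnU.
  by apply: (eq_measurable_fun F) => // x xU; rewrite patchE xU.
- by apply: emeasurable_funM => //; exact/measurable_EFinP.
have : ae_eq mu U rn (EFin \o w).
  apply: integral_ae_eq => //; first exact/measurable_EFinP.
  move=> E EU mE; rewrite -(Radon_Nikodym_SigmaFinite.f_integral density_dominates)//.
  by rewrite /= /density setIidl.
apply: filterS.
by move=> x e Ux; rewrite e// patchE mem_set.
Qed.

Lemma ge0_integral_density F : measurable_fun U F ->
  (forall x, U x -> (0 <= F x)%E) ->
  (\int[(density : set R -> \bar R)]_(x in U) F x =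
   \int[mu]_(x in U) (F x * (w x)%:E))%E.
Proof.
by move=> mF F0; rewrite -ge0_integral_density0// -ge0_integral_realE.
Qed.

Lemma integrable_density f : measurable_fun U f ->
  integrable (density : set R -> \bar R) U (EFin \o f) <->
  mu.-integrable U (fun x => (f x * w x)%:E).
Proof.
move=> mf; have mfw : measurable_fun U (fun x => f x * w x) by exact: measurable_funM.
have E : (\int[(density : set R -> \bar R)]_(x in U) `|(EFin \o f) x| =
    \int[mu]_(x in U) `|(f x * w x)%:E|)%E.
  rewrite ge0_integral_density//.
    apply: eq_integral => x /set_mem Ux.
    by rewrite abse_EFin -EFinM abse_EFin normrM (ger0_norm (w0 Ux)).
  by apply/measurable_EFinP; exact: measurableT_comp.
split=> /integrableP[_ iF]; apply/integrableP; split.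
- exact/measurable_EFinP.
- by rewrite -E.
- exact/measurable_EFinP.
- by rewrite E.
Qed.

Lemma integral_density f : measurable_fun U f ->
  mu.-integrable U (fun x => (f x * w x)%:E) ->
  (\int[(density : set R -> \bar R)]_(x in U) (f x)%:E = \int[mu]_(x in U) (f x * w x)%:E)%E.
Proof.
move=> mf ifw; rewrite integral_realE//; last exact/measurable_EFinP.
rewrite integralE [RHS]integralE.
congr (_ - _)%E; rewrite ge0_integral_density0//.
- apply: eq_integral => x /set_mem Ux.
  rewrite !funeposE -EFin_max -!EFinM -EFin_max maxr_pMl ?w0// mul0r//.
- by apply: measurable_funepos; exact/measurable_EFinP.
- apply: eq_integral => x /set_mem Ux.
  rewrite !funenegE -!EFinN -EFin_max -!EFinM -EFin_max maxr_pMl ?w0// mul0r mulNr//.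
- by apply: measurable_funeneg; exact/measurable_EFinP.
Qed.

End density.

(** * Equality of the Poincare and Hardy constants *)

Section poincare.
Context {R : realType}.
Notation mu := (@lebesgue_measure R).
Variables (a : R) (H : R -> R).
Implicit Types (f g u : R -> R) (beta c : R).
Local Notation U := (`]- a, a[%classic : set R).
Local Notation I := (`]0, a[%classic : set R).
Local Notation W := (gibbs_weight H).

Hypothesis a0 : 0 < a.
Hypothesis mHU : measurable_fun U H.
Hypothesis Heven : forall x, U x -> H (- x) = H x.
Hypothesis Hmono : forall x y, 0 <= y -> y <= x -> x < a -> H y <= H x.
Variable beta : R.
Hypothesis beta0 : 0 <= beta.

Let IU : I `<=` U.
Proof. by move=> x; rewrite /= !in_itv/=; have := a0; lra. Qed.

Let mH : measurable_fun I H.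
Proof. by apply: measurable_funS mHU. Qed.

Lemma gibbs_weight_even x : U x -> W beta (- x) = W beta x.
Proof. by move=> Ux; rewrite /gibbs_weight Heven. Qed.

Lemma gibbs_weight_integrable : mu.-integrable U (EFin \o W beta).
Proof.
apply: (@bounded_itv_integrable _ _ _ _ _ (W beta 0)).
  by apply: measurableT_comp => //; exact: measurable_funM.
move=> x xU; rewrite ger0_norm ?expR_ge0// ler_expR !mulNr lerN2 ler_wpM2l//.
have [x0|x0] := leP 0 x; first by apply: Hmono => //; move: xU; rewrite in_itv/=; lra.
by rewrite -(Heven xU); apply: Hmono => //; move: xU; rewrite in_itv/=; lra.
Qed.

Let mgw : measurable_fun U (W beta).
Proof. by apply/measurable_EFinP; exact: measurable_int gibbs_weight_integrable. Qed.

Definition gibbs_mass : R := \int[mu]_(x in U) W beta x.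

Lemma gibbs_mass_gt0 : 0 < gibbs_mass.
Proof.
apply: Rintegral_itv_gt0; [have := a0; lra|exact: gibbs_weight_integrable|].
by move=> z _; exact: gibbs_weight_gt0.
Qed.

Lemma gibbs_density : gibbs U H beta = density U (fun x => gibbs_mass^-1 * W beta x).
Proof. by []. Qed.

Let iw : mu.-integrable U (EFin \o (fun x => gibbs_mass^-1 * W beta x)).
Proof. by apply: integrableZl_EFin => //; exact: gibbs_weight_integrable. Qed.

Let w0 x : U x -> 0 <= gibbs_mass^-1 * W beta x.
Proof. by move=> _; rewrite mulr_ge0 ?expR_ge0// invr_ge0 ltW// gibbs_mass_gt0. Qed.

Lemma integrable_gibbs f : measurable_fun U f ->
  integrable (gibbs U H beta) U (EFin \o f) <->
  mu.-integrable U (fun x => (f x * W beta x)%:E).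
Proof.
move=> mf; rewrite gibbs_density.
have D := integrable_density (measurable_itv _) w0 iw mf.
have Z0 : gibbs_mass != 0 by rewrite gt_eqF// gibbs_mass_gt0.
split=> [ih0|/(@integrableZl_EFin _ _ _ mu _ gibbs_mass^-1 _ (measurable_itv _)) ih].
- have ih := @integrableZl_EFin _ _ _ mu _ gibbs_mass _ (measurable_itv _) (D.1 ih0).
  by apply: eq_integrable ih => // x _; congr EFin; rewrite mulrCA mulVKf.
- by apply/D.2; apply: eq_integrable ih => // x _; congr EFin; rewrite mulrCA.
Qed.

Lemma integral_gibbs f : measurable_fun U f ->
  mu.-integrable U (fun x => (f x * W beta x)%:E) ->
  (\int[gibbs U H beta]_(x in U) (f x)%:E =
   (gibbs_mass^-1 * \int[mu]_(x in U) (f x * W beta x))%:E)%E.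
Proof.
move=> mf if_; rewrite gibbs_density integral_density//; last first.
  have := @integrableZl_EFin _ _ _ mu _ gibbs_mass^-1 _ (measurable_itv _) if_.
  by apply: eq_integrable => // x _; congr EFin; rewrite mulrCA.
rewrite -RintegralZl// EFin_Rintegral//; last exact: integrableZl_EFin.
by apply: eq_integral => x _; congr EFin; rewrite mulrCA.
Qed.

(** |f| <= 1 + f^2 and the weight has finite mass. *)
Lemma gibbs_weight_integrable_of_sqr f : measurable_fun U f ->
  mu.-integrable U (fun x => (f x ^+ 2 * W beta x)%:E) ->
  mu.-integrable U (fun x => (f x * W beta x)%:E).
Proof.
move=> mf if2.
have i1 := @integrableD_EFin _ _ _ mu _ _ _ (measurable_itv _) gibbs_weight_integrable if2.
apply: (@le_integrable _ _ _ mu _ (measurable_itv _) _ _ _ _ i1).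
  by apply/measurable_EFinP; exact: measurable_funM.
move=> x _; rewrite lee_fin normrM (ger0_norm (expR_ge0 _)).
rewrite [leRHS]ger0_norm; last first.
  apply: addr_ge0; first exact: expR_ge0.
  by rewrite mulr_ge0 ?sqr_ge0 ?expR_ge0.
rewrite -[X in X + _]mul1r -mulrDl ler_wpM2r ?expR_ge0//.
rewrite -(real_normK (num_real (f x))).
by have := sqr_ge0 (`|f x| - 1); have := normr_ge0 (f x); nra.
Qed.

(** From nonnegative to signed functions, by |prim g| <= prim |g|. *)
Lemma hardy_signed c g : hardy a (W beta) c -> measurable_fun U g ->
  (forall b, b < a -> mu.-integrable `[- b, b] (EFin \o g)) ->
  mu.-integrable I (fun x => (g x ^+ 2 * W beta x)%:E) ->
  mu.-integrable I (fun x => (prim g x ^+ 2 * W beta x)%:E) /\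
  \int[mu]_(x in I) (prim g x ^+ 2 * W beta x) <=
  c * \int[mu]_(x in I) (g x ^+ 2 * W beta x).
Proof.
move=> hc mg ig ig2.
have ag : admissible a (W beta) (fun x => `|g x|).
  split=> //; first by apply: measurableT_comp => //; exact: measurable_funS mg.
  by apply: eq_integrable ig2 => // x _; rewrite real_normK// num_real.
have ip := admissible_prim_integrable a0 mH Hmono beta0 ag.
have le x : I x -> prim g x ^+ 2 * W beta x <= prim (fun x => `|g x|) x ^+ 2 * W beta x.
  rewrite /= in_itv/= => /andP[x0 xa]; rewrite ler_wpM2r ?expR_ge0//.
  rewrite -(real_normK (num_real (prim g x))) ler_pXn2r ?nnegrE//; last first.
    by rewrite /prim (ltW x0) Rintegral_ge0.
  rewrite /prim (ltW x0); apply: le_normr_Rintegral => //.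
  by apply: integrableS (ig _ xa) => // y; rewrite /= !in_itv/=; lra.
have ipg : mu.-integrable I (fun x => (prim g x ^+ 2 * W beta x)%:E).
  apply: (@le_integrable _ _ _ mu _ (measurable_itv _) _ _ _ _ ip).
    apply/measurable_EFinP; apply: measurable_funM; last exact: measurable_funS mgw.
    apply: measurable_funX; apply: measurable_funS (prim_measurable ig) => //.
  move=> x /le h; rewrite lee_fin ger0_norm ?(le_trans h) ?ler_norm//.
  by rewrite mulr_ge0 ?sqr_ge0 ?expR_ge0.
split=> //; apply: (le_trans (le_Rintegral _ ipg ip le)) => //.
apply: le_trans (hc _ ag) _.
by under eq_Rintegral do rewrite real_normK ?num_real//.
Qed.

(** On each half interval separately: the weight being even, the left half
reduces to the right one for the reflected function. *)
Lemma hardy_signed_full c g : hardy a (W beta) c -> measurable_fun U g ->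
  (forall b, b < a -> mu.-integrable `[- b, b] (EFin \o g)) ->
  mu.-integrable U (fun x => (g x ^+ 2 * W beta x)%:E) ->
  mu.-integrable U (fun x => (prim g x ^+ 2 * W beta x)%:E) /\
  \int[mu]_(x in U) (prim g x ^+ 2 * W beta x) <=
  c * \int[mu]_(x in U) (g x ^+ 2 * W beta x).
Proof.
move=> hc mg ig ig2.
have ig2I : mu.-integrable I (fun x => (g x ^+ 2 * W beta x)%:E).
  by apply: integrableS ig2.
have oppU : (-%R : R -> R) @^-1` U = U by rewrite oppr_preimage_itv/= opprK.
have mgN : measurable_fun U (fun x => g (- x)).
  by have := measurable_fun_oppr (measurable_itv _) mg; rewrite oppU.
have igN b : b < a -> mu.-integrable `[- b, b] (EFin \o (fun x => g (- x))).
  move=> /ig/(integrable_oppr (measurable_itv _)).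
  by rewrite oppr_preimage_itv/= opprK.
have ig2N : mu.-integrable I (fun x => (g (- x) ^+ 2 * W beta x)%:E).
  have := integrable_oppr (measurable_itv _) ig2; rewrite oppU => ih.
  have {}ih : mu.-integrable I (fun x => (g (- x) ^+ 2 * W beta (- x))%:E).
    by apply: integrableS ih.
  by apply: eq_integrable ih => // x /set_mem/IU Ux; rewrite gibbs_weight_even.
have pN x : I x -> prim (fun y => g (- y)) x ^+ 2 * W beta x =
    prim g (- x) ^+ 2 * W beta (- x).
  move=> Ix; have Ux := IU Ix; move: Ix; rewrite /= in_itv/= => /andP[x0 xa].
  by rewrite gibbs_weight_even// (prim_oppr (ig _ xa)) ?sqrrN// in_itv/= x0 lexx.
have [i1 le1] := hardy_signed hc mg ig ig2I.
have [i2 le2] := hardy_signed hc mgN igN ig2N.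
have i2' : mu.-integrable I (fun x => (prim g (- x) ^+ 2 * W beta (- x))%:E).
  by apply: eq_integrable i2 => // x /set_mem/pN ->.
have ip := integrable_halves a0 i1 i2'.
split=> //; rewrite (Rintegral_halves a0 ip) (Rintegral_halves a0 ig2) mulrDr.
apply: lerD; last exact: le1.
have -> : \int[mu]_(x in I) (prim g (- x) ^+ 2 * W beta (- x)) =
   \int[mu]_(x in I) (prim (fun y => g (- y)) x ^+ 2 * W beta x).
  by apply: eq_Rintegral => x /set_mem/pN ->.
apply: (le_trans le2); rewrite le_eqVlt; apply/orP; left; apply/eqP; congr (_ * _).
by apply: eq_Rintegral => x /set_mem/IU Ux; rewrite gibbs_weight_even.
Qed.

(** By du Bois-Reymond f - prim g is almost everywhere a constant C.  The
variance of f is at most the mean of (f - C)^2 = (prim g)^2, to which the Hardy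
inequality on both halves applies. *)
Lemma hardy_poincare c : hardy a (W beta) c ->
  poincare_inequality (gibbs U H beta) U c.
Proof.
move=> hc f g [wd [mf if2] [mg ig2]].
have [lf lg wdE] := wd.
have {}if2 : mu.-integrable U (fun x => (f x ^+ 2 * W beta x)%:E).
  by apply/integrable_gibbs => //; exact: measurable_funX.
have {}ig2 : mu.-integrable U (fun x => (g x ^+ 2 * W beta x)%:E).
  by apply/integrable_gibbs => //; exact: measurable_funX.
have if1 := gibbs_weight_integrable_of_sqr mf if2.
have ig b : b < a -> mu.-integrable `[- b, b] (EFin \o g).
  exact: locally_integrable_segment.
have [lp _ wdp] := prim_weak_derivative a0 lg.
have [C fC] : exists C, {ae mu, forall x, x \in `]- a, a[ -> f x - prim g x = C}.
  apply: du_bois_reymond => //; first exact: locally_integrableB.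
  move=> phi tphi; have i1 := test_derive_integrable a0 lf tphi.
  have i2 := test_derive_integrable a0 lp tphi.
  under eq_Rintegral do rewrite mulrBl.
  by rewrite RintegralB// /Rintegral wdE// wdp// subrr.
have mp : measurable_fun U (prim g) by exact: prim_measurable.
have [ip pg] := hardy_signed_full hc mg ig ig2.
pose A := \int[mu]_(x in U) (f x ^+ 2 * W beta x).
pose m := \int[mu]_(x in U) (f x * W beta x).
have expand : \int[mu]_(x in U) (prim g x ^+ 2 * W beta x) =
    A - 2 * C * m + C ^+ 2 * gibbs_mass.
  have iC := @integrableZl_EFin _ _ _ mu _ (C ^+ 2) _ (measurable_itv _) gibbs_weight_integrable.
  have im := @integrableZl_EFin _ _ _ mu _ (2 * C) _ (measurable_itv _) if1.
  rewrite /A /m -!RintegralZl//; last exact: gibbs_weight_integrable.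
  rewrite -RintegralB// -RintegralD//; last exact: integrableB_EFin.
  rewrite /Rintegral; congr fine; apply: ae_eq_integral => //.
  - apply/measurable_EFinP; apply: measurable_funM => //; exact: measurable_funX.
  - apply/measurable_EFinP; apply: measurable_funD; last exact: measurable_funM.
    apply: measurable_funB; first by apply: measurable_funM => //; exact: measurable_funX.
    by apply: measurable_funM => //; exact: measurable_funM.
  move: fC; apply: filterS; first exact: (ae_filter_ringOfSetsType mu).
  move=> x fx xU; congr EFin.
  have -> : prim g x = f x - C by rewrite -(fx xU); ring.
  ring.
rewrite !integral_gibbs//; [|exact: measurable_funX..].
rewrite -EFin_expe -!EFinM -EFinB lee_fin -/A -/m.
have M0 := gibbs_mass_gt0; move: pg; rewrite expand.
set B := \int[mu]_(x in U) _ => le.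
(* The variance is the mean of (f - C)^2 minus the square of the mean of
   f - C. *)
have e : gibbs_mass^-1 * A - (gibbs_mass^-1 * m) ^+ 2 =
    gibbs_mass^-1 * (A - 2 * C * m + C ^+ 2 * gibbs_mass) - (gibbs_mass^-1 * m - C) ^+ 2.
  by field; rewrite gt_eqF.
rewrite e lerBlDr; apply: ler_wpDr; first exact: sqr_ge0.
by rewrite mulrCA ler_wpM2l// invr_ge0 ltW.
Qed.

(** For the even extension g of u, prim g is odd and hence of mean zero: its
variance is the mean of its square.  Both sides of the Poincare inequality are
then twice the corresponding integrals over ]0, a[. *)
Lemma poincare_hardy c : poincare_inequality (gibbs U H beta) U c ->
  hardy a (W beta) c.
Proof.
move=> pc u au; have [mu_ u0 iu2] := au.
(* One of the two terms of g x vanishes, according to the sign of x. *)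
pose u' := u \_ I; pose g x := u' x + u' (- x).
have mu' : measurable_fun setT u' by apply/(measurable_restrictT _ _).1.
have mg : measurable_fun setT g.
  by apply: measurable_funD => //; apply: measurableT_comp.
have gN x : g (- x) = g x by rewrite /g opprK addrC.
have gI x : I x -> g x = u x.
  move=> Ix; rewrite /g /u' !patchE mem_set// memNset ?addr0//.
  by move: Ix; rewrite /= !in_itv/=; lra.
have ig b : b < a -> mu.-integrable `[- b, b] (EFin \o g).
  move=> ba; have i1 := admissible_segment_integrable mH Hmono beta0 au ba.
  apply: integrableD_EFin => //.
  have := integrable_oppr (measurable_itv _) i1.
  by rewrite oppr_preimage_itv/= opprK.
have lg : locally_integrable U g.
  by apply: segment_locally_integrable => //; exact: measurable_funTS.
have wd := prim_weak_derivative a0 lg; have [[mp _ _] _ _] := wd.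
have ig2I : mu.-integrable I (fun x => (g x ^+ 2 * W beta x)%:E).
  by apply: eq_integrable iu2 => // x /set_mem/gI ->.
have g2N x : I x -> g (- x) ^+ 2 * W beta (- x) = g x ^+ 2 * W beta x.
  by move=> /IU Ux; rewrite gN gibbs_weight_even.
have ig2 : mu.-integrable U (fun x => (g x ^+ 2 * W beta x)%:E).
  apply: integrable_halves => //.
  by apply: eq_integrable ig2I => // x /set_mem/g2N ->.
have pI x : I x -> prim g x = prim u x.
  rewrite /= in_itv/= => /andP[x0 xa]; rewrite /prim (ltW x0).
  apply: eq_Rintegral => y; rewrite inE/= in_itv/= => yx; apply: gI.
  by rewrite /= in_itv/=; lra.
have pN x : I x -> prim g (- x) = - prim g x.
  rewrite /= in_itv/= => /andP[x0 xa].
  have := prim_oppr (ig _ xa) (_ : x \in `]0, x]).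
  rewrite (_ : (fun y => g (- y)) = g); last exact/funext.
  by rewrite in_itv/= x0 lexx => -> //; rewrite opprK.
have p2N x : I x -> prim g (- x) ^+ 2 * W beta (- x) = prim g x ^+ 2 * W beta x.
  by move=> Ix; rewrite pN// sqrrN gibbs_weight_even//; exact: IU.
have ip2I : mu.-integrable I (fun x => (prim g x ^+ 2 * W beta x)%:E).
  have := admissible_prim_integrable a0 mH Hmono beta0 au.
  by apply: eq_integrable => // x /set_mem/pI ->.
have ip2 : mu.-integrable U (fun x => (prim g x ^+ 2 * W beta x)%:E).
  apply: integrable_halves => //.
  by apply: eq_integrable ip2I => // x /set_mem/p2N ->.
have ip := gibbs_weight_integrable_of_sqr mp ip2.
have ipI : mu.-integrable I (fun x => (prim g x * W beta x)%:E).
  by apply: integrableS ip.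
have mean0 : \int[mu]_(x in U) (prim g x * W beta x) = 0.
  rewrite (Rintegral_halves a0 ip).
  have -> : \int[mu]_(x in I) (prim g (- x) * W beta (- x)) =
      \int[mu]_(x in I) (- 1 * (prim g x * W beta x)).
    apply: eq_Rintegral => x /set_mem Ix.
    by rewrite pN// gibbs_weight_even; [rewrite mulN1r mulNr|exact: IU].
  by rewrite RintegralZl// mulN1r addNr.
have mgU : measurable_fun U g by exact: measurable_funTS.
have h1 : H1_with_derivative (gibbs U H beta) U (prim g) g.
  split=> //; split=> //.
  - by apply/integrable_gibbs => //; exact: measurable_funX.
  - by apply/integrable_gibbs => //; exact: measurable_funX.
have := pc _ _ h1.
rewrite !integral_gibbs//; [|exact: measurable_funX..].
rewrite mean0 mulr0 -EFin_expe expr0n/= sube0 -!EFinM lee_fin.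
rewrite mulrCA ler_pM2l ?invr_gt0 ?gibbs_mass_gt0//.
rewrite (Rintegral_halves a0 ip2) (Rintegral_halves a0 ig2).
have -> : \int[mu]_(x in I) (prim g (- x) ^+ 2 * W beta (- x)) =
    \int[mu]_(x in I) (prim u x ^+ 2 * W beta x).
  by apply: eq_Rintegral => x /set_mem Ix; rewrite p2N// pI.
have -> : \int[mu]_(x in I) (prim g x ^+ 2 * W beta x) =
    \int[mu]_(x in I) (prim u x ^+ 2 * W beta x).
  by apply: eq_Rintegral => x /set_mem Ix; rewrite pI.
have -> : \int[mu]_(x in I) (g (- x) ^+ 2 * W beta (- x)) =
    \int[mu]_(x in I) (u x ^+ 2 * W beta x).
  by apply: eq_Rintegral => x /set_mem Ix; rewrite g2N// gI.
have -> : \int[mu]_(x in I) (g x ^+ 2 * W beta x) =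
    \int[mu]_(x in I) (u x ^+ 2 * W beta x).
  by apply: eq_Rintegral => x /set_mem Ix; rewrite gI.
by rewrite -!mulr2n mulrnAr lerMn2r.
Qed.

End poincare.

(** * Growth of even semi-convex functions *)

Section growth.
Context {R : realType}.
Implicit Types (H : R -> R) (a kappa : R).

(** For 0 <= y <= x with x > 0, y is the convex combination t x + (1 - t)(- x)
with t = (x + y) / (2 x), and the convex function H z - kappa / 2 z^2 takes the
same value at x and - x, hence at y a value that is not larger. *)
Lemma even_semi_convex_growth a H kappa x y :
  even_on `]- a, a[ H -> semi_convex_on `]- a, a[ kappa H ->
  0 <= y -> y <= x -> x < a ->
  kappa / 2 * (x ^+ 2 - y ^+ 2) <= H x - H y.
Proof.
move=> eH cH y0 yx xa.
have [x0|x0] := leP x 0.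
  have -> : x = y by lra.
  by rewrite !subrr mulr0.
have t0 : 0 <= (x + y) / (2 * x) by rewrite divr_ge0//; lra.
have t1 : (x + y) / (2 * x) <= 1 by rewrite ler_pdivrMr ?mulr_gt0//; lra.
have Ux : x \in (`]- a, a[%classic : set R) by rewrite inE/= in_itv/=; lra.
have UNx : - x \in (`]- a, a[%classic : set R) by rewrite inE/= in_itv/=; lra.
have := cH (Itv01 t0 t1) x (- x) Ux UNx.
rewrite !convRE/= eH ?normrN; last by rewrite inE in Ux.
rewrite [conv _ _ _](_ : _ = y); last first.
  transitivity ((x + y) / (2 * x) * x + (1 - (x + y) / (2 * x)) * - x); first by [].
  by field; rewrite gt_eqF.
rewrite /unstable.onem -mulrDl subrKC mul1r.
rewrite (ger0_norm y0) (ger0_norm (ltW x0)); lra.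
Qed.

End growth.

(** * Strict monotonicity *)

Theorem corollary1p5 (R : realType) (a : R) (H : R -> R) (kappa : R) :
  let U : set R := `]- a, a[%classic in
  0 < a -> 0 < kappa ->
  C1_on U H -> even_on U H -> semi_convex_on U kappa H ->
  exists alpha : R -> R,
    (forall beta, 0 <= beta ->
       is_poincare_constant (gibbs U H beta) U (alpha beta)) /\
    (forall beta1 beta2, 0 <= beta1 -> beta1 < beta2 ->
       alpha beta2 < alpha beta1).
Proof.
move=> U a0 k0 C1 eH cH; have mU : measurable U by exact: measurable_itv.
have mHU : measurable_fun U H.
  apply: open_continuous_measurable_fun; first exact: interval_open.
  move=> x /set_mem Ux; have [dH _] := C1 x Ux.
  exact/differentiable_continuous/derivable1_diffP.
have growth x y : 0 <= y -> y <= x -> x < a ->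
    kappa / 2 * (x ^+ 2 - y ^+ 2) <= H x - H y.
  exact: even_semi_convex_growth eH cH.
have Hmono x y : 0 <= y -> y <= x -> x < a -> H y <= H x.
  move=> y0 yx xa; rewrite -subr_ge0; apply: le_trans (growth _ _ y0 yx xa).
  by rewrite mulr_ge0 ?divr_ge0 ?(ltW k0)// subr_ge0 ler_pXn2r ?nnegrE// (le_trans y0).
have mH : measurable_fun `]0, a[ H.
  by apply: measurable_funS mHU => // x; rewrite /U/= !in_itv/=; lra.
have /choice[alpha halpha] : forall beta, exists A, 0 <= beta ->
    [/\ 0 < A, hardy a (gibbs_weight H beta) A &
     forall c, hardy a (gibbs_weight H beta) c -> A <= c].
  move=> beta; have [b0|b0] := leP 0 beta; last by exists 0.
  by have [A hA] := best_hardy a0 mH Hmono b0; exists A.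
exists alpha; split=> [beta b0|].
  have [_ hA minA] := halpha _ b0; split; first exact: hardy_poincare.
  by move=> c /(poincare_hardy a0 mHU eH Hmono b0); exact: minA.
apply: (best_hardy_lt a0 mH Hmono) => // e e0.
(* The values for which a (eta + delta a) = e; outside the strip of width eta,
   H x - H y is at least s. *)
pose eta := e / (2 * a); pose delta := e / (2 * a ^+ 2).
have eta0 : 0 < eta by rewrite divr_gt0 ?mulr_gt0.
have delta0 : 0 < delta by rewrite divr_gt0 ?mulr_gt0 ?exprn_gt0.
pose s := kappa / 2 * eta ^+ 2.
have s0 : 0 < s by rewrite /s mulr_gt0 ?divr_gt0 ?exprn_gt0.
(* For b >= 1 / (delta s), exp (- b s) <= delta since exp (b s) >= b s. *)
exists (delta * s)^-1; first by rewrite invr_ge0 mulr_ge0 ?ltW.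
move=> b Bb; have b0 : 0 <= b by apply: le_trans Bb; rewrite invr_ge0 mulr_ge0 ?ltW.
have [_ _ minA] := halpha _ b0.
have -> : e = a * (eta + delta * a) by rewrite /eta /delta; field; rewrite gt_eqF.
apply: minA; apply: (hardy_of_kernel a0 mH Hmono b0 (ltW eta0) (ltW delta0)).
move=> x y y0 yx xa.
have sH : s <= H x - H y.
  apply: le_trans (growth x y (ltW y0) _ xa); last by lra.
  rewrite /s ler_wpM2l ?divr_ge0 ?(ltW k0)//.
  have -> : x ^+ 2 - y ^+ 2 = (x - y) ^+ 2 + 2 * y * (x - y) by ring.
  rewrite ler_wpDr ?mulr_ge0 ?(ltW y0)//; first by lra.
  by rewrite ler_pXn2r ?nnegrE ?(ltW eta0)//; lra.
rewrite mulNr expRN invf_ple ?posrE ?expR_gt0//.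
apply: le_trans (expR_ge1Dx _); apply: ler_wpDl => //.
apply: le_trans (ler_wpM2l b0 sH).
by rewrite -ler_pdivrMr// -invfM.
Qed.
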